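(* Let $H$ be a quasi-Hopf algebra and $A$ a left $H$-module algebra. Let $j:H\to A\# H$, $j(h)=1_A\# h$. Then the map $$\Pi : A\diamond H_0\to (A\# H)^j,\qquad \Pi(a\otimes h)=x^1\cdot a\,\#\, x^2hS(x^3),\qquad a\in A,\ h\in H,$$ is an isomorphism of left $H$-module algebras.
   Context: Throughout, $k$ is a field, all algebras and linear spaces are over $k$, $\otimes=\otimes_k$. A quasi-bialgebra $(H,\Delta,\varepsilon,\Phi)$ is a unital associative algebra $H$ with algebra maps $\Delta:H\to H\otimes H$, $\varepsilon:H\to k$ and an invertible $\Phi\in H^{\otimes 3}$ such that for all $h\in H$: $(id\otimes\Delta)(\Delta(h))=\Phi(\Delta\otimes id)(\Delta(h))\Phi^{-1}$; $(id\otimes\varepsilon)(\Delta(h))=h=(\varepsilon\otimes id)(\Delta(h))$; $(1\otimes\Phi)(id\otimes\Delta\otimes id)(\Phi)(\Phi\otimes 1)=(id\otimes id\otimes\Delta)(\Phi)(\Delta\otimes id\otimes id)(\Phi)$; $(\varepsilon\otimes id\otimes id)(\Phi)=(id\otimes\varepsilon\otimes id)(\Phi)=(id\otimes id\otimes\varepsilon)(\Phi)=1\otimes 1$. Notation (summation understood): $\Delta(h)=h_1\otimes h_2$; $\Phi=X^1\otimes X^2\otimes X^3=Y^1\otimes Y^2\otimes Y^3=\cdots$ and $\Phi^{-1}=x^1\otimes x^2\otimes x^3=y^1\otimes y^2\otimes y^3=\cdots$ (different letters denote independent copies); lower indices denote components of $\Delta$, e.g. $\Delta(X^3)=X^3_1\otimes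 X^3_2$. A quasi-Hopf algebra is a quasi-bialgebra $H$ with an algebra anti-automorphism $S$ and $\alpha,\beta\in H$ such that $S(h_1)\alpha h_2=\varepsilon(h)\alpha$, $h_1\beta S(h_2)=\varepsilon(h)\beta$ for all $h$, $X^1\beta S(X^2)\alpha X^3=1$, $S(x^1)\alpha x^2\beta S(x^3)=1$; normalised (as one may) so that $\varepsilon(\alpha)=\varepsilon(\beta)=1$ and $\varepsilon\circ S=\varepsilon$. Drinfeld twist: let $A^1\otimes A^2\otimes A^3\otimes A^4=(\Phi\otimes 1)(\Delta\otimes id\otimes id)(\Phi^{-1})$, $B^1\otimes B^2\otimes B^3\otimes B^4=(\Delta\otimes id\otimes id)(\Phi)(\Phi^{-1}\otimes 1)$, $\gamma=S(A^2)\alpha A^3\otimes S(A^1)\alpha A^4$, $\delta=B^1\beta S(B^4)\otimes B^2\beta S(B^3)$, $\Delta^{cop}(h)=h_2\otimes h_1$. Then $f=f^1\otimes f^2=(S\otimes S)(\Delta^{cop}(x^1))\,\gamma\,\Delta(x^2\beta S(x^3))$ is invertible with inverse $f^{-1}=g^1\otimes g^2=\Delta(S(x^1)\alpha x^2)\,\delta\,(S\otimes S)(\Delta^{cop}(x^3))$. Also $q_R=q^1\otimes q^2=X^1\otimes S^{-1}(\alpha X^3)X^2$. A left $H$-module algebra is a left $H$-module $A$ with a multiplication and unit $1_A$ (a usual two-sided unit) such that $(aa')a''=(X^1\cdot a)[(X^2\cdot a')(X^3\cdot a'')]$, $h\cdot(aa')=(h_1\cdot a)(h_2\cdot a')$,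 $h\cdot 1_A=\varepsilon(h)1_A$. Morphisms are $H$-linear, multiplicative, unital maps. The smash product $A\# H$ is $A\otimes H$ with the associative multiplication $(a\# h)(a'\# h')=(x^1\cdot a)(x^2h_1\cdot a')\# x^3h_2h'$ and unit $1_A\# 1$. If $B$ is an associative algebra and $v:H\to B$ an algebra map, $B^v$ is the left $H$-module algebra with underlying space $B$, multiplication $b\star b'=v(X^1)bv(S(x^1X^2)\alpha x^2X^3_1)b'v(S(x^3X^3_2))$, unit $v(\beta)$, action $h\triangleright_v b=v(h_1)bv(S(h_2))$. In particular $H_0:=H^{id_H}$, with multiplication denoted $*$ and action $h\triangleright h'=h_1h'S(h_2)$. Write, for $h\in H_0$, $h_{(-1)}\otimes h_{(0)}=X^1Y^1_1h_1g^1S(q^2Y^2_2)Y^3\otimes X^2Y^1_2h_2g^2S(X^3q^1Y^2_1)\in H\otimes H_0$. $A\diamond H_0$ is the left $H$-module algebra with underlying space $A\otimes H_0$, unit $1_A\otimes\beta$, action $h\cdot(a\otimes h')=h_1\cdot a\otimes h_2\triangleright h'$, and multiplication $$(a\otimes h)(a'\otimes h')=(y^1X^1\cdot a)\big(y^2Y^1(x^1X^2\triangleright h)_{(-1)}x^2X^3_1\cdot a'\big)\otimes\big(y^3_1Y^2\triangleright(x^1X^2\triangleright h)_{(0)}\big)*\big(y^3_2Y^3x^3X^3_2\triangleright h'\big).$$ It is the twisted tensor product of $A$ and $H_0$ in the monoidal category of left $H$-modules afforded by the twisting map $R(h\otimes a)=h_{(-1)}\cdot a\otimes h_{(0)}$.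 *)

(* Defs.v *)
(* Mathematical Components, with the classical axioms of [boolp]: the tensor
   product of two arbitrary vector spaces is a quotient by an undecidable
   relation. *)
From HB Require Import structures.
From mathcomp Require Import all_boot all_order all_algebra.
From mathcomp Require Import boolp classical_sets.

Set Implicit Arguments.
Unset Strict Implicit.
Unset Printing Implicit Defensive.

Import GRing.Theory.
Local Open Scope ring_scope.
Local Open Scope quotient_scope.


Definition is_bilinear (k : fieldType) (U V W : lmodType k)
    (F : U -> V -> W) : Prop :=
  (forall v, linear (F^~ v)) /\ (forall u, linear (F u)).

(* The sequence [:: (u1, v1); ...; (un, vn)] stands for u1 ⊗ v1 + ... + un ⊗ vn;
   the relation is the congruence generated by commutativity of the sum and
   k-bilinearity of ⊗. *)
Section TensorQuotient.
Variables (k : fieldType) (U V : lmodType k).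

Inductive tensor_rel : seq (U * V) -> seq (U * V) -> Prop :=
| TRrefl s : tensor_rel s s
| TRsym s t : tensor_rel s t -> tensor_rel t s
| TRtrans s t r : tensor_rel s t -> tensor_rel t r -> tensor_rel s r
| TRcat s s' t t' :
    tensor_rel s s' -> tensor_rel t t' -> tensor_rel (s ++ t) (s' ++ t')
| TRcomm s t : tensor_rel (s ++ t) (t ++ s)
| TRzero v : tensor_rel [:: (0, v)] [::]
| TRaddl u u' v : tensor_rel [:: (u + u', v)] [:: (u, v); (u', v)]
| TRaddr u v v' : tensor_rel [:: (u, v + v')] [:: (u, v); (u, v')]
| TRscale c u v : tensor_rel [:: (c *: u, v)] [:: (u, c *: v)].

Definition tensor_relb (s t : seq (U * V)) : bool := `[< tensor_rel s t >].

Lemma tensor_relb_equiv : equiv_class_of tensor_relb.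
Proof.
split.
- by move=> s; apply/asboolP/TRrefl.
- by move=> s t; apply/asboolP/asboolP; apply: TRsym.
- by move=> s t r /asboolP st /asboolP tr; apply/asboolP/(TRtrans st tr).
Qed.

Canonical tensor_equiv := EquivRelPack tensor_relb_equiv.

Definition tensor : Type := {eq_quot tensor_equiv}.
HB.instance Definition _ := Choice.on tensor.
HB.instance Definition _ := EqQuotient.on tensor.

Lemma tensor_eqP (s t : seq (U * V)) :
  \pi_tensor s = \pi_tensor t <-> tensor_rel s t.
Proof. by split=> [/eqmodP/asboolP|st] //; apply/eqmodP/asboolP. Qed.

Lemma repr_tensor (s : seq (U * V)) : tensor_rel (repr (\pi_tensor s)) s.
Proof. by apply/tensor_eqP; rewrite reprK. Qed.

Lemma tensor_quotW (P : tensor -> Prop) :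
  (forall s, P (\pi_tensor s)) -> forall x, P x.
Proof. by move=> Ps x; rewrite -[x]reprK; apply: Ps. Qed.

Definition tensor_add (x y : tensor) : tensor := \pi_tensor (repr x ++ repr y).
Definition tensor_scale (c : k) (x : tensor) : tensor :=
  \pi_tensor [seq (c *: p.1, p.2) | p <- repr x].

Lemma tensor_addE s t :
  tensor_add (\pi_tensor s) (\pi_tensor t) = \pi_tensor (s ++ t).
Proof. by apply/tensor_eqP/TRcat; apply: repr_tensor. Qed.

Lemma tensor_rel_scale c s t : tensor_rel s t ->
  tensor_rel [seq (c *: p.1, p.2) | p <- s] [seq (c *: p.1, p.2) | p <- t].
Proof.
elim=> {s t} /=.
- by move=> s; apply: TRrefl.
- by move=> s t _; apply: TRsym.
- by move=> s t r _ st _; apply: TRtrans.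
- by move=> s s' t t' _ ss' _ tt'; rewrite !map_cat; apply: TRcat.
- by move=> s t; rewrite !map_cat; apply: TRcomm.
- by move=> v; rewrite scaler0; apply: TRzero.
- by move=> u u' v; rewrite scalerDr; apply: TRaddl.
- by move=> u v v'; apply: TRaddr.
- by move=> d u v; rewrite scalerA mulrC -scalerA; apply: TRscale.
Qed.

Lemma tensor_scaleE c s :
  tensor_scale c (\pi_tensor s) = \pi_tensor [seq (c *: p.1, p.2) | p <- s].
Proof. by apply/tensor_eqP/tensor_rel_scale/repr_tensor. Qed.

Lemma tensor_addA : associative tensor_add.
Proof.
elim/tensor_quotW=> r; elim/tensor_quotW=> s; elim/tensor_quotW=> t.
by rewrite !tensor_addE catA.
Qed.

Lemma tensor_addC : commutative tensor_add.
Proof.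
elim/tensor_quotW=> s; elim/tensor_quotW=> t; rewrite !tensor_addE.
exact/tensor_eqP/TRcomm.
Qed.

Lemma tensor_add0 : left_id (\pi_tensor [::]) tensor_add.
Proof. by elim/tensor_quotW=> s; rewrite tensor_addE. Qed.

Lemma tensor_rel_scaleD a b s :
  tensor_rel [seq ((a + b) *: p.1, p.2) | p <- s]
    ([seq (a *: p.1, p.2) | p <- s] ++ [seq (b *: p.1, p.2) | p <- s]).
Proof.
elim: s => [|[u v] s IHs] /=; first exact: TRrefl.
set S1 := map _ s in IHs *; set S2 := map _ s in IHs *.
set S3 := map _ s in IHs *.
apply: (@TRtrans _ ([:: (a *: u, v); (b *: u, v)] ++ (S2 ++ S3))).
  by rewrite -cat1s; apply: TRcat IHs; rewrite scalerDl; apply: TRaddl.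
rewrite -cat1s -[_ :: S2 ++ _]cat1s -catA; apply: TRcat (TRrefl _) _.
rewrite -[_ :: S3]cat1s !catA; apply: TRcat (TRrefl _); exact: TRcomm.
Qed.

Lemma tensor_rel_scale0 (s : seq (U * V)) :
  tensor_rel [seq (0 *: p.1, p.2) | p <- s] [::].
Proof.
elim: s => [|[u v] s IHs] /=; first exact: TRrefl.
by apply: (TRcat (_ : tensor_rel [:: _] [::]) IHs); rewrite scale0r; apply: TRzero.
Qed.

Lemma tensor_addN :
  left_inverse (\pi_tensor [::]) (tensor_scale (- 1)) tensor_add.
Proof.
elim/tensor_quotW=> s; rewrite tensor_scaleE tensor_addE; apply/tensor_eqP.
rewrite -[X in tensor_rel (_ ++ X) _]map_id.
rewrite (@eq_map _ _ id (fun p => (1 *: p.1, p.2))); last first.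
  by case=> u v /=; rewrite scale1r.
apply: TRtrans (TRsym (tensor_rel_scaleD _ _ _)) _.
by rewrite addNr; apply: tensor_rel_scale0.
Qed.

HB.instance Definition _ := GRing.isZmodule.Build tensor
  tensor_addA tensor_addC tensor_add0 tensor_addN.

Lemma tensor_scaleA a b x :
  tensor_scale a (tensor_scale b x) = tensor_scale (a * b) x.
Proof.
elim/tensor_quotW: x => s; rewrite !tensor_scaleE -map_comp; congr (\pi_tensor _).
by apply: eq_map => p /=; rewrite scalerA.
Qed.

Lemma tensor_scale1 : left_id 1 tensor_scale.
Proof.
elim/tensor_quotW=> s; rewrite tensor_scaleE; congr (\pi_tensor _).
by rewrite -[RHS]map_id; apply: eq_map => -[u v] /=; rewrite scale1r.
Qed.

Lemma tensor_scaleDr : right_distributive tensor_scale +%R.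
Proof.
move=> c; elim/tensor_quotW=> s; elim/tensor_quotW=> t.
by rewrite /GRing.add /= !(tensor_addE, tensor_scaleE) map_cat.
Qed.

Lemma tensor_scaleDl x : {morph tensor_scale^~ x : a b / a + b}.
Proof.
elim/tensor_quotW: x => s a b.
rewrite [X in _ = X]/GRing.add /= !(tensor_addE, tensor_scaleE).
exact/tensor_eqP/tensor_rel_scaleD.
Qed.

HB.instance Definition _ := GRing.Zmodule_isLmodule.Build k tensor
  tensor_scaleA tensor_scale1 tensor_scaleDr tensor_scaleDl.

Definition tens (u : U) (v : V) : tensor := \pi_tensor [:: (u, v)].

Lemma tens_is_bilinear : is_bilinear tens.
Proof.
have scE c u v : c *: tens u v = tens (c *: u) v.
  by rewrite /GRing.scale /= tensor_scaleE.
split=> [v c u u'|u c v v'].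
  rewrite scE /GRing.add /= tensor_addE; exact/tensor_eqP/TRaddl.
have -> : c *: tens u v = tens u (c *: v).
  by rewrite scE; apply/tensor_eqP/TRscale.
rewrite [X in _ = X]/GRing.add /= tensor_addE; exact/tensor_eqP/TRaddr.
Qed.

Lemma tensor_sumE (s : seq (U * V)) :
  \pi_tensor s = \sum_(p <- s) tens p.1 p.2.
Proof.
elim: s => [|[u v] s IHs]; first by rewrite big_nil.
by rewrite big_cons -IHs /GRing.add /= tensor_addE.
Qed.

Lemma tensorE (x : tensor) : x = \sum_(p <- repr x) tens p.1 p.2.
Proof. by rewrite -tensor_sumE reprK. Qed.

End TensorQuotient.

Arguments tens {k U V} u v : simpl never.

Notation "U ⊗ V" := (tensor U%type V%type)
  (at level 45, left associativity) : type_scope.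
Notation "u ⊗ v" := (tens u v)
  (at level 45, left associativity) : ring_scope.

(* Sweedler-type summation: [tsum x F] is F u1 v1 + ... + F un vn for some
   expression x = u1 ⊗ v1 + ... + un ⊗ vn.  It is meaningful, i.e. independent of
   the chosen expression, when F is bilinear; then it is the linear map induced
   by F (see tsum_tens and tsum_linear). *)
Definition tsum (k : fieldType) (U V : lmodType k) (W : nmodType)
    (x : U ⊗ V) (F : U -> V -> W) : W :=
  \sum_(p <- repr x) F p.1 p.2.

Arguments tsum {k U V W} x F.

Notation "\tsum_ ( x , y <- t ) E" :=
  (tsum t (fun x y => E))
  (at level 46, E at level 46, x name, y name,
   format "\tsum_ ( x ,  y  <-  t )  E") : ring_scope.
Notation "\tsum_ ( x , y , z <- t ) E" :=
  (tsum t (fun w z => tsum w (fun x y => E)))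
  (at level 46, E at level 46, x name, y name, z name,
   format "\tsum_ ( x ,  y ,  z  <-  t )  E") : ring_scope.
Notation "\tsum_ ( x , y , z , u <- t ) E" :=
  (tsum t (fun w u => tsum w (fun w' z => tsum w' (fun x y => E))))
  (at level 46, E at level 46, x name, y name, z name, u name,
   format "\tsum_ ( x ,  y ,  z ,  u  <-  t )  E") : ring_scope.

Section TensorTheory.
Variable k : fieldType.
Implicit Types U V W : lmodType k.

Lemma tensDl U V (u u' : U) (v : V) : (u + u') ⊗ v = u ⊗ v + u' ⊗ v.
Proof.
by have := (tens_is_bilinear U V).1 v 1 u u'; rewrite /= !scale1r.
Qed.

Lemma tensDr U V (u : U) (v v' : V) : u ⊗ (v + v') = u ⊗ v + u ⊗ v'.
Proof.
by have := (tens_is_bilinear U V).2 u 1 v v'; rewrite /= !scale1r.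
Qed.

Lemma is_bilinear0l U V W (F : U -> V -> W) :
  is_bilinear F -> forall v, F 0 v = 0.
Proof.
move=> [Fl _] v; have := Fl v 1 0 0.
by rewrite !scale1r add0r => /eqP; rewrite -subr_eq0 opprD addrA subrr sub0r
  oppr_eq0 => /eqP.
Qed.

Lemma is_bilinear0r U V W (F : U -> V -> W) :
  is_bilinear F -> forall u, F u 0 = 0.
Proof.
move=> [_ Fr] u; have := Fr u 1 0 0.
by rewrite !scale1r add0r => /eqP; rewrite -subr_eq0 opprD addrA subrr sub0r
  oppr_eq0 => /eqP.
Qed.

Lemma tensZl U V c (u : U) (v : V) : (c *: u) ⊗ v = c *: (u ⊗ v).
Proof.
have := (tens_is_bilinear U V).1 v c u 0.
by rewrite /= !addr0 (is_bilinear0l (tens_is_bilinear U V)) addr0.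
Qed.

Lemma tensZr U V c (u : U) (v : V) : u ⊗ (c *: v) = c *: (u ⊗ v).
Proof.
have := (tens_is_bilinear U V).2 u c v 0.
by rewrite /= !addr0 (is_bilinear0r (tens_is_bilinear U V)) addr0.
Qed.

Section Universal.
Variables (U V W : lmodType k) (F : U -> V -> W).
Hypothesis FB : is_bilinear F.

Lemma tensor_rel_sum s t : tensor_rel s t ->
  \sum_(p <- s) F p.1 p.2 = \sum_(p <- t) F p.1 p.2.
Proof.
have [Fl Fr] := FB.
elim=> {s t}.
- by [].
- by move=> s t _ ->.
- by move=> s t r _ -> _ ->.
- by move=> s s' t t' _ e _ e'; rewrite !big_cat /= e e'.
- by move=> s t; rewrite !big_cat /= addrC.
- by move=> v; rewrite big_seq1 big_nil /= is_bilinear0l.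
- move=> u u' v; rewrite !big_cons !big_nil !addr0 /=.
  by have := Fl v 1 u u'; rewrite !scale1r.
- move=> u v v'; rewrite !big_cons !big_nil !addr0 /=.
  by have := Fr u 1 v v'; rewrite !scale1r.
- move=> c u v; rewrite !big_seq1 /=.
  have := Fl v c u 0; have := Fr u c v 0.
  by rewrite !addr0 is_bilinear0r // is_bilinear0l // !addr0 => -> ->.
Qed.

Lemma tsum_pi s : tsum (\pi_(U ⊗ V)%type s) F = \sum_(p <- s) F p.1 p.2.
Proof. exact/tensor_rel_sum/repr_tensor. Qed.

Lemma tsum_tens u v : \tsum_(x, y <- u ⊗ v) F x y = F u v.
Proof. by rewrite /tens tsum_pi big_seq1. Qed.

Lemma tsum_linear : linear (tsum^~ F).
Proof.
move=> c; elim/tensor_quotW=> s; elim/tensor_quotW=> t.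
rewrite [X in tsum (X + _)]/GRing.scale /= tensor_scaleE.
rewrite {1}/GRing.add /= tensor_addE !tsum_pi big_cat big_map /=; congr (_ + _).
rewrite scaler_sumr; apply: eq_bigr => p _ /=.
by have := FB.1 p.2 c p.1 0; rewrite addr0 is_bilinear0l // addr0.
Qed.

End Universal.

Lemma linear_tsum U V W (G : U ⊗ V -> W) : linear G ->
  forall x, G x = \tsum_(u, v <- x) G (u ⊗ v).
Proof.
move=> GL x; rewrite {1}[x]tensorE /tsum.
have G0 : G 0 = 0.
  have := GL 1 0 0.
  by rewrite !scale1r add0r => /eqP; rewrite -subr_eq0 opprD addrA subrr sub0r
    oppr_eq0 => /eqP.
elim/big_ind2: _ => // x1 y1 x2 y2 <- <-.
by have := GL 1 y1 y2; rewrite !scale1r.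
Qed.

Lemma tensor_ext U V W (G G' : U ⊗ V -> W) : linear G -> linear G' ->
  (forall u v, G (u ⊗ v) = G' (u ⊗ v)) -> G =1 G'.
Proof.
move=> GL GL' GG' x; rewrite (linear_tsum GL) (linear_tsum GL').
by apply: eq_bigr => p _; apply: GG'.
Qed.

Lemma tensor_ind U V (P : U ⊗ V -> Prop) :
  P 0 -> (forall x y, P x -> P y -> P (x + y)) ->
  (forall u v, P (u ⊗ v)) -> forall x, P x.
Proof. by move=> P0 PD Pt x; rewrite [x]tensorE; elim/big_ind: _. Qed.

(* A linear functional with value 1 at a given nonzero vector; only used to see
   that the tensor product of two nonzero algebras is nonzero. *)
Lemma functional_exists U (e : U) : e != 0 ->
  exists2 phi : U -> k^o, linear phi & phi e = 1.
Proof.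
move=> e0.
pose closed (M : set U) := forall c x y, M x -> M y -> M (c *: x + y).
pose P (M : set U) := closed M /\ ~ M e.
have [M [[Mcl Me] Mmax]] : exists M, P M /\ forall B, (M `<` B)%classic -> ~ P B.
  apply: Zorn_bigcup => F FP Ftot; split; last first.
    by move=> [X FX Xe]; case: (FP _ FX).
  move=> c x y [X FX Xx] [Y FY Yy].
  have [XY|YX] := Ftot X Y FX FY.
    by exists Y => //; apply: (FP _ FY).1 => //; apply: XY.
  by exists X => //; apply: (FP _ FX).1 => //; apply: YX.
have M0 : M 0.
  apply: contrapT => nM0.
  apply: (Mmax [set 0]%classic).
    split=> [x Mx|/(_ 0 erefl)//].
    by case: nM0; have := Mcl (- 1) x x Mx Mx; rewrite scaleN1r addNr.
  split=> [c x y -> ->|/=]; first by rewrite /= scaler0 addr0.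
  exact/eqP.
have MZ c x : M x -> M (c *: x) by move=> Mx; rewrite -[_ *: _]addr0; apply: Mcl.
have MD x y : M x -> M y -> M (x + y).
  by move=> Mx My; rewrite -[x]scale1r; apply: Mcl.
have ex x : exists c : k, M (x - c *: e).
  apply: contrapT => nex.
  pose M' : set U := [set z | exists m (d : k), M m /\ z = m + d *: x]%classic.
  apply: (Mmax M').
    split=> [m Mm|sub]; first by exists m, 0; rewrite scale0r addr0.
    apply: nex; exists 0; rewrite scale0r subr0; apply: sub.
    by exists 0, 1; rewrite scale1r add0r.
  split=> [c _ _ [m [d [Mm ->]]] [n [b [Mn ->]]]|[m [d [Mm eE]]]].
    exists (c *: m + n), (c * d + b); split; first exact: Mcl.
    by rewrite scalerDr scalerA scalerDl addrACA.
  have [d0|d0] := eqVneq d 0.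
    by apply: Me; rewrite eE d0 scale0r addr0.
  apply: nex; exists d^-1; rewrite eE scalerDr scalerA mulVf // scale1r.
  by rewrite opprD addrCA subrr addr0 -scaleNr; apply: MZ.
pose phi (x : U) : k^o := projT1 (cid (ex x)).
have phiP x : M (x - phi x *: e) by rewrite /phi; case: cid.
have phiU x (c : k) : M (x - c *: e) -> phi x = c.
  move=> Mc; apply/eqP; rewrite -subr_eq0; apply/negPn/negP => ne.
  apply: Me; rewrite -[e]scale1r -(mulVf ne) -scalerA scalerBl; apply: (MZ).
  have -> : phi x *: e - c *: e = (x - c *: e) + - 1 *: (x - phi x *: e).
    by rewrite scaleN1r opprB [RHS]addrC addrA subrK.
  by apply: MD => //; apply: MZ; apply: phiP.
exists phi; last by apply: phiU; rewrite scale1r subrr.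
move=> c x y; apply: phiU.
have -> : c *: x + y - (c *: phi x + phi y : k^o) *: e =
          c *: (x - phi x *: e) + (y - phi y *: e).
  by rewrite scalerDl scalerBr scalerA opprD addrACA.
by apply: Mcl; apply: phiP.
Qed.

Lemma tens_neq0 U V (u : U) (v : V) : u != 0 -> v != 0 -> u ⊗ v != 0.
Proof.
move=> /functional_exists[f fL f1] /functional_exists[g gL g1].
pose F (x : U) (y : V) : k^o := f x * g y.
have FB : is_bilinear F.
  split=> [y c x x'|x c y y'] /=; rewrite /F.
    by rewrite fL mulrDl scalerAl.
  by rewrite gL mulrDr scalerAr.
apply/eqP => uv0; have := tsum_tens FB u v.
rewrite uv0 /F f1 g1 mulr1.
have := tsum_linear FB 1 0 0; rewrite !scale1r add0r => /eqP.
rewrite -subr_eq0 opprD addrA subrr sub0r oppr_eq0 => /eqP -> /esym/eqP.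
by rewrite oner_eq0.
Qed.

End TensorTheory.

Section TensorAlgebra.
Variables (k : fieldType) (A B : algType k).

Definition tensor_mul (s t : A ⊗ B) : A ⊗ B :=
  \tsum_(a, b <- s) \tsum_(a', b' <- t) (a * a') ⊗ (b * b').

Let inner_bilinear a b :
  is_bilinear (fun (a' : A) (b' : B) => (a * a') ⊗ (b * b')).
Proof.
split=> [b' c x y|a' c x y] /=.
  by rewrite mulrDr tensDl -scalerAr tensZl.
by rewrite mulrDr tensDr -scalerAr tensZr.
Qed.

Let outer_bilinear (t : A ⊗ B) :
  is_bilinear (fun a b => \tsum_(a', b' <- t) (a * a') ⊗ (b * b')).
Proof.
split=> [b c x y|a c x y] /=;
  rewrite /tsum scaler_sumr -big_split /=; apply: eq_bigr => p _.
  by rewrite mulrDl tensDl -scalerAl tensZl.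
by rewrite mulrDl tensDr -scalerAl tensZr.
Qed.

Lemma tensor_mulE a b a' b' :
  tensor_mul (a ⊗ b) (a' ⊗ b') = (a * a') ⊗ (b * b').
Proof. by rewrite /tensor_mul !tsum_tens. Qed.

Lemma tensor_mull_linear t : linear (tensor_mul^~ t).
Proof. exact: (tsum_linear (outer_bilinear t)). Qed.

Lemma tensor_mulr_linear s : linear (tensor_mul s).
Proof.
move=> c x y; rewrite /tensor_mul /tsum scaler_sumr -big_split /=.
apply: eq_bigr => p _; exact: (tsum_linear (inner_bilinear _ _)).
Qed.

Lemma tensor_mulDl : left_distributive tensor_mul +%R.
Proof. by move=> x y t; have := tensor_mull_linear t 1 x y; rewrite !scale1r. Qed.

Lemma tensor_mulDr : right_distributive tensor_mul +%R.
Proof. by move=> s x y; have := tensor_mulr_linear s 1 x y; rewrite !scale1r. Qed.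

Lemma tensor_mul0l t : tensor_mul 0 t = 0.
Proof. by apply: (addIr (tensor_mul 0 t)); rewrite -tensor_mulDl !add0r. Qed.

Lemma tensor_mul0r s : tensor_mul s 0 = 0.
Proof. by apply: (addIr (tensor_mul s 0)); rewrite -tensor_mulDr !add0r. Qed.

Lemma tensor_mulA : associative tensor_mul.
Proof.
elim/tensor_ind=> [s t|x y IHx IHy s t|a b].
- by rewrite !tensor_mul0l.
- by rewrite !tensor_mulDl IHx IHy.
elim/tensor_ind=> [t|x y IHx IHy t|a' b'].
- by rewrite !(tensor_mul0l, tensor_mul0r).
- by rewrite !(tensor_mulDl, tensor_mulDr) IHx IHy.
elim/tensor_ind=> [|x y IHx IHy|a'' b''].
- by rewrite !tensor_mul0r.
- by rewrite !tensor_mulDr IHx IHy.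
by rewrite !tensor_mulE !mulrA.
Qed.

Lemma tensor_mul1l : left_id (1 ⊗ 1) tensor_mul.
Proof.
elim/tensor_ind=> [|x y IHx IHy|a b]; first exact: tensor_mul0r.
  by rewrite tensor_mulDr IHx IHy.
by rewrite tensor_mulE !mul1r.
Qed.

Lemma tensor_mul1r : right_id (1 ⊗ 1) tensor_mul.
Proof.
elim/tensor_ind=> [|x y IHx IHy|a b]; first exact: tensor_mul0l.
  by rewrite tensor_mulDl IHx IHy.
by rewrite tensor_mulE !mulr1.
Qed.

Lemma tensor_one_neq0 : (1 : A) ⊗ (1 : B) != 0.
Proof. by apply: tens_neq0; apply: oner_neq0. Qed.

HB.instance Definition _ := GRing.Zmodule_isNzRing.Build (A ⊗ B)%type
  tensor_mulA tensor_mul1l tensor_mul1r tensor_mulDl tensor_mulDr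
  tensor_one_neq0.

Lemma tensor_scaleAl (c : k) (s t : A ⊗ B) : c *: (s * t) = (c *: s) * t.
Proof.
have := tensor_mull_linear t c s 0.
by rewrite /GRing.mul /= tensor_mul0l !addr0.
Qed.

HB.instance Definition _ :=
  GRing.Lmodule_isLalgebra.Build k (A ⊗ B)%type tensor_scaleAl.

Lemma tensor_scaleAr (c : k) (s t : A ⊗ B) : c *: (s * t) = s * (c *: t).
Proof.
have := tensor_mulr_linear s c t 0.
by rewrite /GRing.mul /= tensor_mul0r !addr0.
Qed.

HB.instance Definition _ :=
  GRing.Lalgebra_isAlgebra.Build k (A ⊗ B)%type tensor_scaleAr.

End TensorAlgebra.

(* H ⊗ H ⊗ H is (H ⊗ H) ⊗ H, and likewise for four factors. *)
Record quasi_bialgebra (k : fieldType) := QuasiBialgebra {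
  qb_algebra :> algType k;
  coprod : {lrmorphism qb_algebra -> (qb_algebra ⊗ qb_algebra)%type};
  counit : {lrmorphism qb_algebra -> k | *%R};
  reassoc : qb_algebra ⊗ qb_algebra ⊗ qb_algebra;
  reassocV : qb_algebra ⊗ qb_algebra ⊗ qb_algebra;
  reassoc_mulV : reassoc * reassocV = 1;
  reassoc_Vmul : reassocV * reassoc = 1;
  quasi_coassoc : forall h : qb_algebra,
    \tsum_(h1, h2 <- coprod h) \tsum_(h21, h22 <- coprod h2) h1 ⊗ h21 ⊗ h22
    = reassoc * (\tsum_(h1, h2 <- coprod h) coprod h1 ⊗ h2) * reassocV;
  counit_r : forall h : qb_algebra,
    \tsum_(h1, h2 <- coprod h) counit h2 *: h1 = h;
  counit_l : forall h : qb_algebra,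
    \tsum_(h1, h2 <- coprod h) counit h1 *: h2 = h;
  pentagon :
    (\tsum_(X1, X2, X3 <- reassoc) 1 ⊗ X1 ⊗ X2 ⊗ X3)
    * (\tsum_(X1, X2, X3 <- reassoc)
       \tsum_(X21, X22 <- coprod X2) X1 ⊗ X21 ⊗ X22 ⊗ X3)
    * (reassoc ⊗ 1)
    = (\tsum_(X1, X2, X3 <- reassoc)
       \tsum_(X31, X32 <- coprod X3) X1 ⊗ X2 ⊗ X31 ⊗ X32)
      * (\tsum_(X1, X2, X3 <- reassoc) coprod X1 ⊗ X2 ⊗ X3);
  counit_reassoc1 :
    \tsum_(X1, X2, X3 <- reassoc) counit X1 *: (X2 ⊗ X3) = 1;
  counit_reassoc2 :
    \tsum_(X1, X2, X3 <- reassoc) counit X2 *: (X1 ⊗ X3) = 1;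
  counit_reassoc3 :
    \tsum_(X1, X2, X3 <- reassoc) counit X3 *: (X1 ⊗ X2) = 1
}.

Arguments coprod {k q}.
Arguments counit {k q}.
Arguments reassoc {k} q.
Arguments reassocV {k} q.

Record quasi_hopf (k : fieldType) := QuasiHopf {
  qh_bialgebra :> quasi_bialgebra k;
  antipode : {linear qh_bialgebra -> qh_bialgebra};
  antipodeV : qh_bialgebra -> qh_bialgebra;
  antipodeK : cancel antipode antipodeV;
  antipodeVK : cancel antipodeV antipode;
  antipode1 : antipode 1 = 1;
  antipodeM : forall h h' : qh_bialgebra,
    antipode (h * h') = antipode h' * antipode h;
  qalpha : qh_bialgebra;
  qbeta : qh_bialgebra;
  antipode_alpha : forall h : qh_bialgebra,
    \tsum_(h1, h2 <- coprod h) antipode h1 * qalpha * h2 = counit h *: qalpha;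
  antipode_beta : forall h : qh_bialgebra,
    \tsum_(h1, h2 <- coprod h) h1 * qbeta * antipode h2 = counit h *: qbeta;
  reassoc_antipode :
    \tsum_(X1, X2, X3 <- reassoc qh_bialgebra)
      X1 * qbeta * antipode X2 * qalpha * X3 = 1;
  reassocV_antipode :
    \tsum_(x1, x2, x3 <- reassocV qh_bialgebra)
      antipode x1 * qalpha * x2 * qbeta * antipode x3 = 1;
  counit_alpha : counit qalpha = 1;
  counit_beta : counit qbeta = 1;
  counit_antipode : forall h : qh_bialgebra, counit (antipode h) = counit h
}.

Arguments antipode {k q}.
Arguments antipodeV {k q}.
Arguments qalpha {k} q.
Arguments qbeta {k} q.

Section QuasiHopfElements.
Variables (k : fieldType) (H : quasi_hopf k).
Local Notation "'Φ'" := (reassoc H).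
Local Notation "'Φ^-1'" := (reassocV H).
Local Notation Δ := coprod.
Local Notation S := antipode.
Local Notation α := (qalpha H).
Local Notation β := (qbeta H).

Definition twist_delta : H ⊗ H :=
  let B := (\tsum_(X1, X2, X3 <- Φ) Δ X1 ⊗ X2 ⊗ X3) * (Φ^-1 ⊗ 1) in
  \tsum_(B1, B2, B3, B4 <- B) B1 * β * S B4 ⊗ B2 * β * S B3.

(* g1 ⊗ g2, the inverse of the Drinfeld twist f, by its explicit formula *)
Definition drinfeld_twistV : H ⊗ H :=
  \tsum_(x1, x2, x3 <- Φ^-1)
    Δ (S x1 * α * x2) * twist_delta
    * (\tsum_(x31, x32 <- Δ x3) S x32 ⊗ S x31).

Definition q_R : H ⊗ H :=
  \tsum_(X1, X2, X3 <- Φ) X1 ⊗ antipodeV (α * X3) * X2.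

(* h_(-1) ⊗ h_(0) *)
Definition H0_coaction (h : H) : H ⊗ H :=
  \tsum_(X1, X2, X3 <- Φ) \tsum_(Y1, Y2, Y3 <- Φ)
  \tsum_(Y11, Y12 <- Δ Y1) \tsum_(Y21, Y22 <- Δ Y2)
  \tsum_(h1, h2 <- Δ h) \tsum_(g1, g2 <- drinfeld_twistV)
  \tsum_(q1, q2 <- q_R)
    X1 * Y11 * h1 * g1 * S (q2 * Y22) * Y3
    ⊗ X2 * Y12 * h2 * g2 * S (X3 * q1 * Y21).

End QuasiHopfElements.

(* A vector space with a multiplication and a unit, no axiom being required:
   module algebras need not be associative, and zero is allowed. *)
Record pre_algebra (k : fieldType) := PreAlgebra {
  pa_space :> lmodType k;
  pa_mul : pa_space -> pa_space -> pa_space;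
  pa_one : pa_space
}.

Record pre_module_algebra (k : fieldType) (H : algType k) :=
  PreModuleAlgebra {
    pma_algebra :> pre_algebra k;
    pma_act : H -> pma_algebra -> pma_algebra
  }.

Arguments pa_mul {k} p x y.
Arguments pa_one {k} p.
Arguments pma_act {k H} p h x.

Definition pre_algebra_of (k : fieldType) (B : algType k) : pre_algebra k :=
  @PreAlgebra k B *%R 1.

Record is_module_algebra (k : fieldType) (H : quasi_bialgebra k)
    (A : pre_module_algebra H) : Prop := IsModuleAlgebra {
  ma_act_bilinear : is_bilinear (pma_act A);
  ma_act1 : forall a : A, pma_act A 1 a = a;
  ma_actM : forall (h h' : H) (a : A),
    pma_act A (h * h') a = pma_act A h (pma_act A h' a);
  ma_mul_bilinear : is_bilinear (pa_mul A);
  ma_mul1l : forall a : A, pa_mul A (pa_one A) a = a;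
  ma_mul1r : forall a : A, pa_mul A a (pa_one A) = a;
  ma_mulA : forall a a' a'' : A,
    pa_mul A (pa_mul A a a') a''
    = \tsum_(X1, X2, X3 <- reassoc H)
        pa_mul A (pma_act A X1 a) (pa_mul A (pma_act A X2 a') (pma_act A X3 a''));
  ma_act_mul : forall (h : H) (a a' : A),
    pma_act A h (pa_mul A a a')
    = \tsum_(h1, h2 <- coprod h) pa_mul A (pma_act A h1 a) (pma_act A h2 a');
  ma_act_one : forall h : H, pma_act A h (pa_one A) = counit h *: pa_one A
}.

Record module_algebra (k : fieldType) (H : quasi_bialgebra k) :=
  ModuleAlgebra {
    ma_pre :> pre_module_algebra H;
    ma_axioms : is_module_algebra ma_pre
  }.

Record is_module_algebra_morphism (k : fieldType) (H : algType k)
    (A B : pre_module_algebra H) (f : A -> B) : Prop :=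
  IsModuleAlgebraMorphism {
    mam_linear : linear f;
    mam_act : forall (h : H) (a : A), f (pma_act A h a) = pma_act B h (f a);
    mam_mul : forall a a' : A, f (pa_mul A a a') = pa_mul B (f a) (f a');
    mam_one : f (pa_one A) = pa_one B
  }.

Record is_module_algebra_iso (k : fieldType) (H : quasi_bialgebra k)
    (A B : pre_module_algebra H) (f : A -> B) : Prop :=
  IsModuleAlgebraIso {
    mai_source : is_module_algebra A;
    mai_target : is_module_algebra B;
    mai_morphism : is_module_algebra_morphism f;
    mai_bijective : bijective f
  }.

Section Constructions.
Variables (k : fieldType) (H : quasi_hopf k).
Local Notation "'Φ'" := (reassoc H).
Local Notation "'Φ^-1'" := (reassocV H).
Local Notation Δ := coprod.
Local Notation S := antipode.
Local Notation α := (qalpha H).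
Local Notation β := (qbeta H).

(* B^v; it is a module algebra when B is associative and unital and v is an
   algebra map.  H0 is the case v = id. *)
Definition algebra_along (B : pre_algebra k) (v : H -> B) :
    pre_module_algebra H :=
  let mul3 b b' b'' := pa_mul B (pa_mul B b b') b'' in
  let mul5 a b c d e := mul3 (mul3 a b c) d e in
  @PreModuleAlgebra k H
    (@PreAlgebra k B
      (fun b b' =>
        \tsum_(X1, X2, X3 <- Φ) \tsum_(x1, x2, x3 <- Φ^-1)
        \tsum_(X31, X32 <- Δ X3)
          mul5 (v X1) b (v (S (x1 * X2) * α * x2 * X31)) b' (v (S (x3 * X32))))
      (v β))
    (fun (h : H) (b : B) => \tsum_(h1, h2 <- Δ h) mul3 (v h1) b (v (S h2))).

Definition H0 : pre_module_algebra H :=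
  @algebra_along (pre_algebra_of H) id.

Variable A : pre_module_algebra H.
Local Notation "a ∙ a'" := (pa_mul A a a') (at level 40, left associativity).
Local Notation "h · a" := (pma_act A h a) (at level 35, right associativity).
Local Notation "h ⋆ h'" := (pa_mul H0 h h') (at level 40, left associativity).
Local Notation "h ▷ h'" := (pma_act H0 h h')
  (at level 35, right associativity).

Definition smash : pre_algebra k :=
  @PreAlgebra k (A ⊗ H)%type
    (fun s t =>
      \tsum_(a, h <- s) \tsum_(a', h' <- t)
      \tsum_(x1, x2, x3 <- Φ^-1) \tsum_(h1, h2 <- Δ h)
        (x1 · a) ∙ ((x2 * h1) · a') ⊗ x3 * h2 * h')
    (pa_one A ⊗ 1).

(* j *)
Definition smash_inclusion (h : H) : smash := pa_one A ⊗ h.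

(* A ⋄ H_0 *)
Definition diamond : pre_module_algebra H :=
  @PreModuleAlgebra k H
    (@PreAlgebra k (A ⊗ H)%type
      (fun s t =>
        \tsum_(a, h <- s) \tsum_(a', h' <- t)
        \tsum_(X1, X2, X3 <- Φ) \tsum_(X31, X32 <- Δ X3)
        \tsum_(x1, x2, x3 <- Φ^-1)
        \tsum_(Y1, Y2, Y3 <- Φ)
        \tsum_(y1, y2, y3 <- Φ^-1) \tsum_(y31, y32 <- Δ y3)
        \tsum_(c, h0 <- H0_coaction ((x1 * X2) ▷ h))
          ((y1 * X1) · a) ∙ ((y2 * Y1 * c * x2 * X31) · a')
          ⊗ (((y31 * Y2) ▷ h0) ⋆ ((y32 * Y3 * x3 * X32) ▷ h')))
      (pa_one A ⊗ β))
    (fun (h : H) t =>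
      \tsum_(a, h' <- t) \tsum_(h1, h2 <- Δ h) (h1 · a) ⊗ (h2 ▷ h')).

(* Π *)
Definition diamond_to_smash (t : diamond) :
    algebra_along smash_inclusion :=
  \tsum_(a, h <- t) \tsum_(x1, x2, x3 <- Φ^-1) (x1 · a) ⊗ x2 * h * S x3.

End Constructions.

Lemma diamond_to_smash_tens (k : fieldType) (H : quasi_hopf k)
    (A : module_algebra H) (a : A) (h : H) :
  diamond_to_smash (A := A) (a ⊗ h)
  = \tsum_(x1, x2, x3 <- reassocV H) pma_act A x1 a ⊗ x2 * h * antipode x3.
Proof.
have [_ actl] := ma_act_bilinear (ma_axioms A).
rewrite /diamond_to_smash tsum_tens //; split=> [h' c b b'|b c h' h''] /=;
  rewrite /tsum scaler_sumr -big_split /=; apply: eq_bigr => p _;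
  rewrite scaler_sumr -big_split /=; apply: eq_bigr => q _.
  by rewrite actl tensDl tensZl.
by rewrite mulrDr mulrDl tensDr -scalerAr -scalerAl tensZr.
Qed.

(* Main.v *)
Require Import Defs.
From mathcomp Require Import all_boot all_order all_algebra.

(** Let B be an associative algebra and v : H -> B an algebra map.  The operator
    ψ(b) = v(X^1) b v(S(X^2) α X^3) satisfies
      v(h) ψ(b) = ψ(h_1 ▷ b) v(h_2),
      b = ψ(x^1 ▷ b) v(x^2 β S(x^3)),
      b ⋆ b' = ψ(x^1 ▷ b) v(x^2) b' v(S(x^3)),
      ψ(b ⋆ b') = ψ(X^1 ▷ b) ψ(X^2 ▷ b') v(X^3),
    and the module algebra axioms of B^v follow from these formally.

    For B = A # H the map ι(a) = x^1 · a # x^2 β S(x^3) is a morphism of module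
    algebras A -> (A # H)^j with ψ(ι(a)) = a # 1, and j is one H_0 -> (A # H)^j.
    The formula for ⋆ gives Π(a ⊗ h) = ι(a) ⋆ j(h), so Π is multiplicative by
    reassociation as soon as j(h) ⋆ ι(a) = ι(h_(-1) · a) ⋆ j(h_(0)).  This reduces to
      g^1 S(h_2) ⊗ g^2 S(h_1) = Δ(S(h)) f^{-1},
      g^1 S(q^2) ⊗ g^2 S(q^1) = Δ(S(x^1) α x^2) p_R (1 ⊗ S(x^3)),
    where p_R = x^1 ⊗ x^2 β S(x^3); both are computed from the explicit formula
    for f^{-1}.  The inverse of Π is a # h ↦ X^1 · a ⊗ X^2 h S(X^3), and the axioms
    for the source are transported along Π. *)

Set Implicit Arguments.
Unset Strict Implicit.
Unset Printing Implicit Defensive.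

Import GRing.Theory.
Local Open Scope ring_scope.

(** * Sums over tensors *)

(** Behind ψ there is a module. Let H act on B by h · m = v(h) m; then b ⊗ m ↦ ψ(b) m is an action
    of B^v on B in the monoidal category of left H-modules. The first of the four identities for ψ
    is its H-linearity, the last its associativity up to Φ. So the axioms of B^v are checked inside
    B, whose product is strictly associative. The obvious map a ↦ a # 1 cannot replace ι, since (a #
    1)(a' # 1) = (x^1 · a)(x^2 · a') # x^3. The twist f^{-1} enters only where j is moved past ι.
    Transport along Π avoids a direct check of the coherence of the twisting map R. A tensor is a
    class of lists and \tsum evaluates a chosen representative: an identity between tensors applies
    to a sum only when the summand is multilinear. This accounts for the many linearity side
    conditions. *)

Section TensorSums.
Variable k : fieldType.
Implicit Types U V W X : lmodType k.

Lemma eq_tsum U V (W : nmodType) (t : U ⊗ V) (F G : U -> V -> W) :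
  (forall u v, F u v = G u v) -> tsum t F = tsum t G.
Proof. by move=> FG; apply: eq_bigr => p _; apply: FG. Qed.

Lemma eq_tsum3 U1 U2 U3 (W : nmodType) (t : U1 ⊗ U2 ⊗ U3)
    (F G : U1 -> U2 -> U3 -> W) :
  (forall u v w, F u v w = G u v w) ->
  \tsum_(u, v, w <- t) F u v w = \tsum_(u, v, w <- t) G u v w.
Proof. by move=> FG; apply: eq_tsum => p w; apply: eq_tsum => u v. Qed.

Lemma linear_add U V (f : U -> V) : linear f -> forall x y, f (x + y) = f x + f y.
Proof. by move=> fL x y; have := fL 1 x y; rewrite !scale1r. Qed.

Lemma linear_0 U V (f : U -> V) : linear f -> f 0 = 0.
Proof.
by move=> fL; apply: (addIr (f 0)); rewrite -(linear_add fL) !add0r.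
Qed.

Lemma linear_scale U V (f : U -> V) :
  linear f -> forall c x, f (c *: x) = c *: f x.
Proof. by move=> fL c x; have := fL c x 0; rewrite (linear_0 fL) !addr0. Qed.

Lemma linear_tsumE U V W W' (f : W -> W') (t : U ⊗ V) (F : U -> V -> W) :
  linear f -> f (tsum t F) = \tsum_(u, v <- t) f (F u v).
Proof.
move=> fL; apply: (big_morph f (linear_add fL)); exact: linear_0.
Qed.

Lemma linear_tsum3E U1 U2 U3 W W' (f : W -> W') (t : U1 ⊗ U2 ⊗ U3)
    (F : U1 -> U2 -> U3 -> W) :
  linear f -> f (\tsum_(u, v, w <- t) F u v w) = \tsum_(u, v, w <- t) f (F u v w).
Proof.
by move=> fL; rewrite linear_tsumE //; apply: eq_tsum => p w; apply: linear_tsumE.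
Qed.

Lemma tsum_exchange U V U' V' (W : nmodType) (s : U ⊗ V) (t : U' ⊗ V')
    (F : U -> V -> U' -> V' -> W) :
  \tsum_(a, b <- s) \tsum_(c, d <- t) F a b c d
  = \tsum_(c, d <- t) \tsum_(a, b <- s) F a b c d.
Proof. exact: exchange_big. Qed.

Lemma tsum3_exchange U V U1 U2 U3 (W : nmodType) (s : U ⊗ V)
    (t : U1 ⊗ U2 ⊗ U3) (F : U -> V -> U1 -> U2 -> U3 -> W) :
  \tsum_(a, b <- s) \tsum_(c, d, e <- t) F a b c d e
  = \tsum_(c, d, e <- t) \tsum_(a, b <- s) F a b c d e.
Proof.
by rewrite tsum_exchange; apply: eq_tsum => p w; apply: tsum_exchange.
Qed.

Lemma tsum33_exchange U V X U1 U2 U3 (W : nmodType) (s : U ⊗ V ⊗ X)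
    (t : U1 ⊗ U2 ⊗ U3) (F : U -> V -> X -> U1 -> U2 -> U3 -> W) :
  \tsum_(a, b, x <- s) \tsum_(c, d, e <- t) F a b x c d e
  = \tsum_(c, d, e <- t) \tsum_(a, b, x <- s) F a b x c d e.
Proof.
by rewrite -[RHS]tsum3_exchange; apply: eq_tsum => p w; apply: tsum3_exchange.
Qed.

Lemma linear_ident U : linear (fun x : U => x).
Proof. by []. Qed.

Lemma linear_compose U V W (g : V -> W) (f : U -> V) :
  linear g -> linear f -> linear (fun x => g (f x)).
Proof. by move=> gL fL c x y; rewrite fL gL. Qed.

Lemma linear_tsuml U V W X (f : X -> U ⊗ V) (F : U -> V -> W) :
  linear f -> (forall v, linear (fun u => F u v)) ->
  (forall u, linear (fun v => F u v)) -> linear (fun x => tsum (f x) F).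
Proof.
by move=> fL F1 F2; apply: (linear_compose (g := fun t => tsum t F)) fL;
  apply: tsum_linear.
Qed.

Lemma linear_tsumr U V W X (t : U ⊗ V) (F : X -> U -> V -> W) :
  (forall u v, linear (fun x => F x u v)) -> linear (fun x => tsum t (F x)).
Proof.
move=> FL c x y; rewrite /tsum scaler_sumr -big_split /=.
by apply: eq_bigr => p _; apply: FL.
Qed.

Lemma linear_tensl U V X (f : X -> U) (v : V) :
  linear f -> linear (fun x => f x ⊗ v).
Proof. exact: linear_compose ((tens_is_bilinear U V).1 v). Qed.

Lemma linear_tensr U V X (f : X -> V) (u : U) :
  linear f -> linear (fun x => u ⊗ f x).
Proof. exact: linear_compose ((tens_is_bilinear U V).2 u). Qed.

Lemma linear_mull (B : algType k) X (f : X -> B) (b : B) :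
  linear f -> linear (fun x => f x * b).
Proof. by move=> fL c x y; rewrite fL mulrDl scalerAl. Qed.

Lemma linear_mulr (B : algType k) X (f : X -> B) (b : B) :
  linear f -> linear (fun x => b * f x).
Proof. by move=> fL c x y; rewrite fL mulrDr scalerAr. Qed.

Lemma linear_scaler V X (f : X -> V) (a : k) :
  linear f -> linear (fun x => a *: f x).
Proof. by move=> fL c x y; rewrite fL scalerDr !scalerA mulrC. Qed.

Lemma linear_counit (H : quasi_bialgebra k) X V (f : X -> H) (v : V) :
  linear f -> linear (fun x => counit (f x) *: v).
Proof. by move=> fL c x y; rewrite fL linearP scalerDl scalerA. Qed.

Lemma linear_coprod (H : quasi_bialgebra k) X (f : X -> H) :
  linear f -> linear (fun x => coprod (f x)).
Proof. by move=> fL c x y; rewrite fL linearP. Qed.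

Lemma linear_antipode (H : quasi_hopf k) X (f : X -> H) :
  linear f -> linear (fun x => antipode (f x)).
Proof. by move=> fL c x y; rewrite fL linearP. Qed.

End TensorSums.

Arguments linear_compose {k U V W g f}.

(* Syntax-directed proof that an expression depends linearly on one variable;
   the multilinearity of variables is looked up in the context. *)
Ltac linear_tac :=
  cbv beta;
  lazymatch goal with
  | |- GRing.linear_for _ (fun x => _) => idtac
  | |- GRing.linear_for ?s ?f => change (GRing.linear_for s (fun x => f x))
  | |- _ => idtac
  end;
  match goal with
  | |- forall _, _ => intro; linear_tac
  | |- _ /\ _ => split; linear_tac
  | |- is_bilinear _ => split; linear_tac
  | h : ?P |- ?P => exact h
  | |- GRing.linear_for _ (fun x => x) => exact: linear_ident
  | |- GRing.linear_for _ (fun x => tsum ?t (@?F x)) =>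
      apply: linear_tsumr; linear_tac
  | |- GRing.linear_for _ (fun x => tsum (@?t x) ?F) =>
      apply: linear_tsuml; linear_tac
  | |- GRing.linear_for _ (fun x => tens (@?f x) ?v) =>
      apply: linear_tensl; linear_tac
  | |- GRing.linear_for _ (fun x => tens ?v (@?f x)) =>
      apply: linear_tensr; linear_tac
  | |- GRing.linear_for _ (fun x => @?f x * ?v) =>
      apply: linear_mull; linear_tac
  | |- GRing.linear_for _ (fun x => ?v * (@?f x)) =>
      apply: linear_mulr; linear_tac
  | |- GRing.linear_for _ (fun x => @?f x *: ?v) =>
      apply: linear_counit; linear_tac
  | |- GRing.linear_for _ (fun x => ?a *: (@?f x)) =>
      apply: linear_scaler; linear_tac
  | h : is_bilinear ?F |- GRing.linear_for _ (fun x => ?F (@?f x) ?b) =>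
      apply: (linear_compose (proj1 h b)); linear_tac
  | h : is_bilinear ?F |- GRing.linear_for _ (fun x => ?F ?a (@?f x)) =>
      apply: (linear_compose (proj2 h a)); linear_tac
  | h : forall b c, GRing.linear_for _ (fun a => ?F a b c)
    |- GRing.linear_for _ (fun x => ?F (@?f x) ?b ?c) =>
      apply: (linear_compose (h b c)); linear_tac
  | h : forall a c, GRing.linear_for _ (fun b => ?F a b c)
    |- GRing.linear_for _ (fun x => ?F ?a (@?f x) ?c) =>
      apply: (linear_compose (h a c)); linear_tac
  | h : forall a b, GRing.linear_for _ (fun c => ?F a b c)
    |- GRing.linear_for _ (fun x => ?F ?a ?b (@?f x)) =>
      apply: (linear_compose (h a b)); linear_tac
  | h : forall b c d, GRing.linear_for _ (fun a => ?F a b c d)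
    |- GRing.linear_for _ (fun x => ?F (@?f x) ?b ?c ?d) =>
      apply: (linear_compose (h b c d)); linear_tac
  | h : forall a c d, GRing.linear_for _ (fun b => ?F a b c d)
    |- GRing.linear_for _ (fun x => ?F ?a (@?f x) ?c ?d) =>
      apply: (linear_compose (h a c d)); linear_tac
  | h : forall a b d, GRing.linear_for _ (fun c => ?F a b c d)
    |- GRing.linear_for _ (fun x => ?F ?a ?b (@?f x) ?d) =>
      apply: (linear_compose (h a b d)); linear_tac
  | h : forall a b c, GRing.linear_for _ (fun d => ?F a b c d)
    |- GRing.linear_for _ (fun x => ?F ?a ?b ?c (@?f x)) =>
      apply: (linear_compose (h a b c)); linear_tac
  | h : GRing.linear_for _ ?F |- GRing.linear_for _ (fun x => ?F (@?f x)) =>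
      apply: (linear_compose h); linear_tac
  | |- _ => apply: linear_coprod; linear_tac
  | |- _ => apply: linear_antipode; linear_tac
  end.

(** * Multilinear maps out of tensor products *)

Section MultilinearSums.
Variable k : fieldType.
Implicit Types U V W X : lmodType k.

Definition trilinear U1 U2 U3 W (F : U1 -> U2 -> U3 -> W) : Prop :=
  [/\ forall b c, linear (fun a => F a b c),
      forall a c, linear (fun b => F a b c) &
      forall a b, linear (fun c => F a b c)].

Definition quadrilinear U1 U2 U3 U4 W (F : U1 -> U2 -> U3 -> U4 -> W) : Prop :=
  [/\ forall b c d, linear (fun a => F a b c d),
      forall a c d, linear (fun b => F a b c d),
      forall a b d, linear (fun c => F a b c d) &
      forall a b c, linear (fun d => F a b c d)].

Lemma tsum_tsum U V U' V' W (t : U ⊗ V) (F : U -> V -> U' ⊗ V')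
    (G : U' -> V' -> W) : is_bilinear G ->
  tsum (tsum t F) G = \tsum_(u, v <- t) tsum (F u v) G.
Proof. by move=> GB; apply: (linear_tsumE (f := tsum^~ G)); apply: tsum_linear. Qed.

Lemma tsum3_tens U1 U2 U3 W (F : U1 -> U2 -> U3 -> W) x y z : trilinear F ->
  \tsum_(a, b, c <- x ⊗ y ⊗ z) F a b c = F x y z.
Proof. by case=> F1 F2 F3; rewrite !tsum_tens //; linear_tac. Qed.

Lemma tsum4_tens U1 U2 U3 U4 W (F : U1 -> U2 -> U3 -> U4 -> W) x y z w :
  quadrilinear F -> \tsum_(a, b, c, d <- x ⊗ y ⊗ z ⊗ w) F a b c d = F x y z w.
Proof. by case=> F1 F2 F3 F4; rewrite !tsum_tens //; linear_tac. Qed.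

Lemma tsum3_linear U1 U2 U3 W (F : U1 -> U2 -> U3 -> W) : trilinear F ->
  linear (fun t => \tsum_(a, b, c <- t) F a b c).
Proof. by case=> F1 F2 F3; linear_tac. Qed.

Lemma tsum4_linear U1 U2 U3 U4 W (F : U1 -> U2 -> U3 -> U4 -> W) :
  quadrilinear F -> linear (fun t => \tsum_(a, b, c, d <- t) F a b c d).
Proof. by case=> F1 F2 F3 F4; linear_tac. Qed.

Lemma tensorE3 U1 U2 U3 (t : U1 ⊗ U2 ⊗ U3) :
  t = \tsum_(a, b, c <- t) a ⊗ b ⊗ c.
Proof.
rewrite {1}(linear_tsum (@linear_ident _ _) t); apply: eq_tsum => p c.
by rewrite (linear_tsum (G := fun p => p ⊗ c)) //; linear_tac.
Qed.

Lemma tensM (A B : algType k) (a a' : A) (b b' : B) :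
  (a ⊗ b) * (a' ⊗ b') = (a * a') ⊗ (b * b').
Proof. exact: tensor_mulE. Qed.

Section Multiplicative.
Variables (B : algType k) (A1 A2 A3 : algType k) (G : A1 -> A2 -> A3 -> B).
Hypothesis G3 : trilinear G.
Hypothesis GM : forall a b c a' b' c',
  G (a * a') (b * b') (c * c') = G a b c * G a' b' c'.

Lemma tsum3M (s t : A1 ⊗ A2 ⊗ A3) :
  \tsum_(a, b, c <- s * t) G a b c
  = (\tsum_(a, b, c <- s) G a b c) * (\tsum_(a, b, c <- t) G a b c).
Proof.
have [G1 G2 G3'] := G3.
rewrite {1}[s]tensorE3 {1}[t]tensorE3.
rewrite (linear_tsum3E _ _
  (f := fun s' => \tsum_(a, b, c <- s' * _) G a b c)); last by linear_tac.
rewrite (linear_tsum3E _ _ (f := fun x => x * _)); last by linear_tac.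
apply: eq_tsum3 => a b c.
rewrite (linear_tsum3E _ _
  (f := fun s' => \tsum_(a, b, c <- _ * s') G a b c)); last by linear_tac.
rewrite (linear_tsum3E _ _ (f := fun x => _ * x)); last by linear_tac.
apply: eq_tsum3 => a' b' c'.
by rewrite -GM -(tsum3_tens (F := G)) // !tensM.
Qed.

(** A multilinear, multiplicative and unital [G] induces an algebra map on the tensor product. This
    makes each of the five factors of the pentagon invertible. *)
Lemma tsum3_inv (s t : A1 ⊗ A2 ⊗ A3) : G 1 1 1 = 1 -> s * t = 1 ->
  (\tsum_(a, b, c <- s) G a b c) * (\tsum_(a, b, c <- t) G a b c) = 1.
Proof. by move=> G1 st1; rewrite -tsum3M st1 -G1; apply: tsum3_tens. Qed.

End Multiplicative.

End MultilinearSums.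

Section ProductSums.
Variables (k : fieldType).

Lemma tsum_mul (A B : algType k) (W : lmodType k) (F : A -> B -> W)
    (s t : A ⊗ B) : is_bilinear F ->
  tsum (s * t) F = \tsum_(a, b <- s) \tsum_(c, d <- t) F (a * c) (b * d).
Proof.
move=> FB; rewrite {1}/GRing.mul /= /tensor_mul tsum_tsum //.
apply: eq_tsum => a b; rewrite tsum_tsum //; apply: eq_tsum => c d.
exact: tsum_tens.
Qed.

Lemma tsum3_mul (A1 A2 A3 : algType k) (W : lmodType k)
    (F : A1 -> A2 -> A3 -> W) (s t : A1 ⊗ A2 ⊗ A3) : trilinear F ->
  \tsum_(a, b, c <- s * t) F a b c
  = \tsum_(a, b, c <- s) \tsum_(a', b', c' <- t) F (a * a') (b * b') (c * c').
Proof.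
case=> F1 F2 F3; rewrite tsum_mul; last by linear_tac.
apply: eq_tsum => p c; rewrite [RHS]tsum_exchange; apply: eq_tsum => p' c'.
by apply: tsum_mul; linear_tac.
Qed.

Lemma mul_tsuml (B : algType k) (U V : lmodType k) (t : U ⊗ V)
    (F : U -> V -> B) y :
  (\tsum_(a, b <- t) F a b) * y = \tsum_(a, b <- t) F a b * y.
Proof. by apply: (linear_tsumE (f := fun x => x * y)); linear_tac. Qed.

Lemma mul_tsumr (B : algType k) (U V : lmodType k) (t : U ⊗ V)
    (F : U -> V -> B) y :
  y * (\tsum_(a, b <- t) F a b) = \tsum_(a, b <- t) y * F a b.
Proof. by apply: (linear_tsumE (f := fun x => y * x)); linear_tac. Qed.

Lemma mul_tsum3l (B : algType k) (U V X : lmodType k) (t : U ⊗ V ⊗ X)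
    (F : U -> V -> X -> B) y :
  (\tsum_(a, b, c <- t) F a b c) * y = \tsum_(a, b, c <- t) F a b c * y.
Proof. by apply: (linear_tsum3E _ _ (f := fun x => x * y)); linear_tac. Qed.

Lemma mul_tsum3r (B : algType k) (U V X : lmodType k) (t : U ⊗ V ⊗ X)
    (F : U -> V -> X -> B) y :
  y * (\tsum_(a, b, c <- t) F a b c) = \tsum_(a, b, c <- t) y * F a b c.
Proof. by apply: (linear_tsum3E _ _ (f := fun x => y * x)); linear_tac. Qed.

End ProductSums.

(* An identity in a tensor power of H is stated as an equality of sums of F(...)
   for every multilinear F, the form in which it applies under \tsum. *)
Section QuasiBialgebraSums.
Variables (k : fieldType) (H : quasi_bialgebra k).
Local Notation "'Φ'" := (reassoc H).
Local Notation "'Φ^-1'" := (reassocV H).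
Local Notation Δ := coprod.
Local Notation ε := counit.

Section Coproduct.
Variable W : lmodType k.

Lemma coprodM_sum (F : H -> H -> W) (h h' : H) : is_bilinear F ->
  \tsum_(a, b <- Δ (h * h')) F a b
  = \tsum_(h1, h2 <- Δ h) \tsum_(h1', h2' <- Δ h') F (h1 * h1') (h2 * h2').
Proof. by move=> FB; rewrite rmorphM; apply: tsum_mul. Qed.

Lemma coprod1_sum (F : H -> H -> W) : is_bilinear F ->
  \tsum_(a, b <- Δ (1 : H)) F a b = F 1 1.
Proof. by move=> FB; rewrite rmorph1; apply: tsum_tens. Qed.

Lemma counit_r_sum (F : H -> W) (h : H) : linear F ->
  \tsum_(h1, h2 <- Δ h) ε h2 *: F h1 = F h.
Proof.
move=> FL; rewrite -{2}[h]counit_r linear_tsumE //.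
by apply: eq_tsum => a b; rewrite linear_scale.
Qed.

Lemma counit_l_sum (F : H -> W) (h : H) : linear F ->
  \tsum_(h1, h2 <- Δ h) ε h1 *: F h2 = F h.
Proof.
move=> FL; rewrite -{2}[h]counit_l linear_tsumE //.
by apply: eq_tsum => a b; rewrite linear_scale.
Qed.

Lemma reassoc_mulV_sum (F : H -> H -> H -> W) : trilinear F ->
  \tsum_(X1, X2, X3 <- Φ) \tsum_(x1, x2, x3 <- Φ^-1)
    F (X1 * x1) (X2 * x2) (X3 * x3) = F 1 1 1.
Proof.
move=> FL; rewrite -tsum3_mul // reassoc_mulV; exact: tsum3_tens.
Qed.

Lemma reassoc_Vmul_sum (F : H -> H -> H -> W) : trilinear F ->
  \tsum_(x1, x2, x3 <- Φ^-1) \tsum_(X1, X2, X3 <- Φ)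
    F (x1 * X1) (x2 * X2) (x3 * X3) = F 1 1 1.
Proof.
move=> FL; rewrite -tsum3_mul // reassoc_Vmul; exact: tsum3_tens.
Qed.

Lemma counit_reassoc1_sum (F : H -> H -> W) : is_bilinear F ->
  \tsum_(X1, X2, X3 <- Φ) ε X1 *: F X2 X3 = F 1 1.
Proof.
move=> FB; rewrite -(tsum_tens FB 1 1) -[1 ⊗ 1](counit_reassoc1 H).
rewrite (linear_tsum3E _ _ (f := tsum^~ F)); last exact: tsum_linear.
by apply: eq_tsum3 => X1 X2 X3; rewrite (linear_scale (tsum_linear FB)) tsum_tens.
Qed.

Lemma counit_reassoc2_sum (F : H -> H -> W) : is_bilinear F ->
  \tsum_(X1, X2, X3 <- Φ) ε X2 *: F X1 X3 = F 1 1.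
Proof.
move=> FB; rewrite -(tsum_tens FB 1 1) -[1 ⊗ 1](counit_reassoc2 H).
rewrite (linear_tsum3E _ _ (f := tsum^~ F)); last exact: tsum_linear.
by apply: eq_tsum3 => X1 X2 X3; rewrite (linear_scale (tsum_linear FB)) tsum_tens.
Qed.

Lemma counit_reassoc3_sum (F : H -> H -> W) : is_bilinear F ->
  \tsum_(X1, X2, X3 <- Φ) ε X3 *: F X1 X2 = F 1 1.
Proof.
move=> FB; rewrite -(tsum_tens FB 1 1) -[1 ⊗ 1](counit_reassoc3 H).
rewrite (linear_tsum3E _ _ (f := tsum^~ F)); last exact: tsum_linear.
by apply: eq_tsum3 => X1 X2 X3; rewrite (linear_scale (tsum_linear FB)) tsum_tens.
Qed.

(** ε is an algebra map, so applying it to the first leg of Φ^{-1}Φ = 1 and using the normalisation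
    of Φ gives that of Φ^{-1}. In the proof the normalisation is read backwards, to insert a copy of
    Φ. The other two legs are alike. *)
Lemma counit_reassocV1_sum (F : H -> H -> W) : is_bilinear F ->
  \tsum_(x1, x2, x3 <- Φ^-1) ε x1 *: F x2 x3 = F 1 1.
Proof.
move=> FB; pose G (a b c : H) : W := ε a *: F b c.
have GT : trilinear G by rewrite /G; split; linear_tac.
transitivity (G 1 1 1); last by rewrite /G rmorph1 scale1r.
rewrite -(reassoc_Vmul_sum GT); apply: eq_tsum3 => x1 x2 x3.
rewrite -{1}[x2]mulr1 -{1}[x3]mulr1.
rewrite -(counit_reassoc1_sum (F := fun a b => F (x2 * a) (x3 * b))); last by linear_tac.
rewrite (linear_tsum3E _ _ (f := fun w => ε x1 *: w)); last by linear_tac.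
by apply: eq_tsum3 => X1 X2 X3; rewrite /G rmorphM scalerA.
Qed.

Lemma counit_reassocV2_sum (F : H -> H -> W) : is_bilinear F ->
  \tsum_(x1, x2, x3 <- Φ^-1) ε x2 *: F x1 x3 = F 1 1.
Proof.
move=> FB; pose G (a b c : H) : W := ε b *: F a c.
have GT : trilinear G by rewrite /G; split; linear_tac.
transitivity (G 1 1 1); last by rewrite /G rmorph1 scale1r.
rewrite -(reassoc_Vmul_sum GT); apply: eq_tsum3 => x1 x2 x3.
rewrite -{1}[x1]mulr1 -{1}[x3]mulr1.
rewrite -(counit_reassoc2_sum (F := fun a b => F (x1 * a) (x3 * b))); last by linear_tac.
rewrite (linear_tsum3E _ _ (f := fun w => ε x2 *: w)); last by linear_tac.
by apply: eq_tsum3 => X1 X2 X3; rewrite /G rmorphM scalerA.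
Qed.

Lemma counit_reassocV3_sum (F : H -> H -> W) : is_bilinear F ->
  \tsum_(x1, x2, x3 <- Φ^-1) ε x3 *: F x1 x2 = F 1 1.
Proof.
move=> FB; pose G (a b c : H) : W := ε c *: F a b.
have GT : trilinear G by rewrite /G; split; linear_tac.
transitivity (G 1 1 1); last by rewrite /G rmorph1 scale1r.
rewrite -(reassoc_Vmul_sum GT); apply: eq_tsum3 => x1 x2 x3.
rewrite -{1}[x1]mulr1 -{1}[x2]mulr1.
rewrite -(counit_reassoc3_sum (F := fun a b => F (x1 * a) (x2 * b))); last by linear_tac.
rewrite (linear_tsum3E _ _ (f := fun w => ε x3 *: w)); last by linear_tac.
by apply: eq_tsum3 => X1 X2 X3; rewrite /G rmorphM scalerA.
Qed.

(** Quasi-coassociativity multiplied by Φ on the right, so that each side carries a single Φ and no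
    inverse. [coassocV_sum] is its multiple by Φ^{-1} on the left. *)
Lemma coassoc_sum (F : H -> H -> H -> W) (h : H) : trilinear F ->
  \tsum_(X1, X2, X3 <- Φ) \tsum_(h1, h2 <- Δ h) \tsum_(a, b <- Δ h1)
     F (X1 * a) (X2 * b) (X3 * h2)
  = \tsum_(X1, X2, X3 <- Φ) \tsum_(h1, h2 <- Δ h) \tsum_(a, b <- Δ h2)
     F (h1 * X1) (a * X2) (b * X3).
Proof.
move=> FT; have [F1 F2 F3] := FT.
pose f t := \tsum_(a, b, c <- t) F a b c.
have fL : linear f by apply: tsum3_linear.
have /(congr1 (fun t => f (t * Φ))) := quasi_coassoc h.
rewrite -[_ * Φ^-1 * Φ]mulrA reassoc_Vmul mulr1.
set C := \tsum_(h1, h2 <- Δ h) _; set D := \tsum_(h1, h2 <- Δ h) _.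
move=> CD; transitivity (f (Φ * D)); last rewrite -CD.
  rewrite /f tsum3_mul //; apply: eq_tsum3 => X1 X2 X3.
  rewrite (linear_tsumE (f := fun t => tsum t _)); last by linear_tac.
  apply: eq_tsum => h1 h2; rewrite tsum_tens //; linear_tac.
rewrite /f tsum3_mul // tsum33_exchange; apply: eq_tsum3 => X1 X2 X3.
rewrite (linear_tsumE (f := fun t => tsum t _)); last by linear_tac.
apply: eq_tsum => h1 h2.
rewrite (linear_tsumE (f := fun t => tsum t _)); last by linear_tac.
by apply: eq_tsum => a b; rewrite tsum3_tens //; split; linear_tac.
Qed.

Lemma coassocV_sum (F : H -> H -> H -> W) (h : H) : trilinear F ->
  \tsum_(x1, x2, x3 <- Φ^-1) \tsum_(h1, h2 <- Δ h) \tsum_(a, b <- Δ h1)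
     F (a * x1) (b * x2) (h2 * x3)
  = \tsum_(x1, x2, x3 <- Φ^-1) \tsum_(h1, h2 <- Δ h) \tsum_(a, b <- Δ h2)
     F (x1 * h1) (x2 * a) (x3 * b).
Proof.
move=> FT; have [F1 F2 F3] := FT.
pose f t := \tsum_(a, b, c <- t) F a b c.
have fL : linear f by apply: tsum3_linear.
have /(congr1 (fun t => f (Φ^-1 * t))) := quasi_coassoc h.
rewrite !mulrA reassoc_Vmul mul1r.
set C := \tsum_(h1, h2 <- Δ h) _; set D := \tsum_(h1, h2 <- Δ h) _.
move=> CD; transitivity (f (D * Φ^-1)); last rewrite -CD.
  rewrite /f tsum3_mul // tsum33_exchange; apply: eq_tsum3 => x1 x2 x3.
  rewrite (linear_tsumE (f := fun t => tsum t _)); last by linear_tac.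
  apply: eq_tsum => h1 h2; rewrite tsum_tens //; linear_tac.
rewrite /f tsum3_mul //; apply: eq_tsum3 => x1 x2 x3.
rewrite (linear_tsumE (f := fun t => tsum t _)); last by linear_tac.
apply: eq_tsum => h1 h2.
rewrite (linear_tsumE (f := fun t => tsum t _)); last by linear_tac.
by apply: eq_tsum => a b; rewrite tsum3_tens //; split; linear_tac.
Qed.

End Coproduct.
End QuasiBialgebraSums.

(** * The pentagon *)

Section Pentagon.
Variables (k : fieldType) (H : quasi_bialgebra k).
Local Notation "'Φ'" := (reassoc H).
Local Notation "'Φ^-1'" := (reassocV H).
Local Notation Δ := coprod.

(* Proving the consequences of the pentagon in an abstract algebra R in place of
   H ⊗ H ⊗ H ⊗ H spares the unifier the nested tensor structures. *)
Lemma tensor4_model : exists (R : algType k) (T : H -> H -> H -> H -> R),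
  [/\ quadrilinear T,
      forall a b c d a' b' c' d',
        T (a * a') (b * b') (c * c') (d * d') = T a b c d * T a' b' c' d',
      T 1 1 1 1 = 1,
      (\tsum_(X1, X2, X3 <- Φ) T 1 X1 X2 X3)
      * (\tsum_(X1, X2, X3 <- Φ) \tsum_(a, b <- Δ X2) T X1 a b X3)
      * (\tsum_(X1, X2, X3 <- Φ) T X1 X2 X3 1)
      = (\tsum_(X1, X2, X3 <- Φ) \tsum_(a, b <- Δ X3) T X1 X2 a b)
        * (\tsum_(X1, X2, X3 <- Φ) \tsum_(a, b <- Δ X1) T a b X2 X3) &
      forall (W : lmodType k) (F : H -> H -> H -> H -> W), quadrilinear F ->
        exists2 ev : R -> W, linear ev & forall a b c d, ev (T a b c d) = F a b c d].
Proof.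
exists ((H ⊗ H ⊗ H) ⊗ H)%type, (fun a b c d => a ⊗ b ⊗ c ⊗ d); split.
- by split; linear_tac.
- by move=> *; rewrite !tensM.
- by [].
- have := pentagon H; congr (_ * _ = _).
    rewrite [in LHS](tensorE3 Φ).
    by rewrite (linear_tsum3E _ _ (f := fun t => t ⊗ 1)) //; linear_tac.
  congr (_ * _); apply: eq_tsum3 => a b c.
  rewrite (linear_tsum (G := fun t => t ⊗ b ⊗ c)) //; linear_tac.
- move=> W F FQ; exists (fun t => \tsum_(a, b, c, d <- t) F a b c d).
    exact: tsum4_linear.
  by move=> a b c d; apply: tsum4_tens.
Qed.

Section Consequences.
Variables (R : algType k) (T : H -> H -> H -> H -> R).
Hypothesis TQ : quadrilinear T.
Hypothesis TM : forall a b c d a' b' c' d',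
  T (a * a') (b * b') (c * c') (d * d') = T a b c d * T a' b' c' d'.
Hypothesis T1 : T 1 1 1 1 = 1.

(** The five algebra maps from triple to quadruple tensors in the pentagon: a unit inserted at the
    left or right end, or Δ applied to one leg. [Phi_] and [PhiV_] denote the images of Φ and
    Φ^{-1}. *)
Let pad_l (a b c : H) : R := T 1 a b c.
Let pad_r (a b c : H) : R := T a b c 1.
Let dup1 (a b c : H) : R := \tsum_(a1, a2 <- Δ a) T a1 a2 b c.
Let dup2 (a b c : H) : R := \tsum_(b1, b2 <- Δ b) T a b1 b2 c.
Let dup3 (a b c : H) : R := \tsum_(c1, c2 <- Δ c) T a b c1 c2.

Let Phi_l := \tsum_(a, b, c <- Φ) pad_l a b c.
Let Phi_r := \tsum_(a, b, c <- Φ) pad_r a b c.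
Let Phi_1 := \tsum_(a, b, c <- Φ) dup1 a b c.
Let Phi_2 := \tsum_(a, b, c <- Φ) dup2 a b c.
Let Phi_3 := \tsum_(a, b, c <- Φ) dup3 a b c.
Let PhiV_l := \tsum_(a, b, c <- Φ^-1) pad_l a b c.
Let PhiV_r := \tsum_(a, b, c <- Φ^-1) pad_r a b c.
Let PhiV_1 := \tsum_(a, b, c <- Φ^-1) dup1 a b c.
Let PhiV_2 := \tsum_(a, b, c <- Φ^-1) dup2 a b c.
Let PhiV_3 := \tsum_(a, b, c <- Φ^-1) dup3 a b c.

Let pad_lM a b c a' b' c' :
  pad_l (a * a') (b * b') (c * c') = pad_l a b c * pad_l a' b' c'.
Proof. by rewrite -TM mulr1. Qed.

Let pad_rM a b c a' b' c' :
  pad_r (a * a') (b * b') (c * c') = pad_r a b c * pad_r a' b' c'.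
Proof. by rewrite -TM mulr1. Qed.

Let dup1M a b c a' b' c' :
  dup1 (a * a') (b * b') (c * c') = dup1 a b c * dup1 a' b' c'.
Proof.
have [Ta Tb Tc Td] := TQ.
rewrite /dup1 coprodM_sum; last by linear_tac.
rewrite mul_tsuml; apply: eq_tsum => h1 h2; rewrite mul_tsumr.
by apply: eq_tsum => h1' h2'; rewrite TM.
Qed.

Let dup2M a b c a' b' c' :
  dup2 (a * a') (b * b') (c * c') = dup2 a b c * dup2 a' b' c'.
Proof.
have [Ta Tb Tc Td] := TQ.
rewrite /dup2 coprodM_sum; last by linear_tac.
rewrite mul_tsuml; apply: eq_tsum => h1 h2; rewrite mul_tsumr.
by apply: eq_tsum => h1' h2'; rewrite TM.
Qed.

Let dup3M a b c a' b' c' :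
  dup3 (a * a') (b * b') (c * c') = dup3 a b c * dup3 a' b' c'.
Proof.
have [Ta Tb Tc Td] := TQ.
rewrite /dup3 coprodM_sum; last by linear_tac.
rewrite mul_tsuml; apply: eq_tsum => h1 h2; rewrite mul_tsumr.
by apply: eq_tsum => h1' h2'; rewrite TM.
Qed.

Let pad_l_trilinear : trilinear pad_l.
Proof. by have [Ta Tb Tc Td] := TQ; split; rewrite /pad_l; linear_tac. Qed.

Let pad_r_trilinear : trilinear pad_r.
Proof. by have [Ta Tb Tc Td] := TQ; split; rewrite /pad_r; linear_tac. Qed.

Let dup1_trilinear : trilinear dup1.
Proof. by have [Ta Tb Tc Td] := TQ; split; rewrite /dup1; linear_tac. Qed.

Let dup2_trilinear : trilinear dup2.
Proof. by have [Ta Tb Tc Td] := TQ; split; rewrite /dup2; linear_tac. Qed.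

Let dup3_trilinear : trilinear dup3.
Proof. by have [Ta Tb Tc Td] := TQ; split; rewrite /dup3; linear_tac. Qed.

Let dup1_1 : dup1 1 1 1 = 1.
Proof.
by have [Ta Tb Tc Td] := TQ; rewrite /dup1 coprod1_sum //; linear_tac.
Qed.

Let dup2_1 : dup2 1 1 1 = 1.
Proof.
by have [Ta Tb Tc Td] := TQ; rewrite /dup2 coprod1_sum //; linear_tac.
Qed.

Let dup3_1 : dup3 1 1 1 = 1.
Proof.
by have [Ta Tb Tc Td] := TQ; rewrite /dup3 coprod1_sum //; linear_tac.
Qed.

Let Phi_lK : PhiV_l * Phi_l = 1.
Proof.
by apply: (tsum3_inv pad_l_trilinear pad_lM); [exact: T1 | exact: reassoc_Vmul].
Qed.

Let Phi_rV : Phi_r * PhiV_r = 1.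
Proof.
by apply: (tsum3_inv pad_r_trilinear pad_rM); [exact: T1 | exact: reassoc_mulV].
Qed.

Let Phi_1V : Phi_1 * PhiV_1 = 1.
Proof.
by apply: (tsum3_inv dup1_trilinear dup1M); [exact: dup1_1 | exact: reassoc_mulV].
Qed.

Let Phi_2V : Phi_2 * PhiV_2 = 1.
Proof.
by apply: (tsum3_inv dup2_trilinear dup2M); [exact: dup2_1 | exact: reassoc_mulV].
Qed.

Let PhiV_2K : PhiV_2 * Phi_2 = 1.
Proof.
by apply: (tsum3_inv dup2_trilinear dup2M); [exact: dup2_1 | exact: reassoc_Vmul].
Qed.

Let Phi_3V : Phi_3 * PhiV_3 = 1.
Proof.
by apply: (tsum3_inv dup3_trilinear dup3M); [exact: dup3_1 | exact: reassoc_mulV].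
Qed.

Let PhiV_3K : PhiV_3 * Phi_3 = 1.
Proof.
by apply: (tsum3_inv dup3_trilinear dup3M); [exact: dup3_1 | exact: reassoc_Vmul].
Qed.

Hypothesis pentagon_mul : Phi_l * Phi_2 * Phi_r = Phi_3 * Phi_1.

(** The pentagon is solved in four ways. The first serves the associativity of ⋆ and the
    contractions [pentagon_alpha1] and [pentagon_beta1], the second the associativity of A # H, the
    third [pentagon_alpha2], the fourth the formula for f^{-1}. The left sides of the first and
    third are the elements A and B in the definitions of γ and δ. *)
Let pentagon_mul1 : Phi_r * PhiV_1 = PhiV_2 * PhiV_l * Phi_3.
Proof.
rewrite -[LHS]mul1r -PhiV_2K -[in LHS](mulr1 PhiV_2) -Phi_lK -!mulrA.
rewrite [Phi_2 * _]mulrA [Phi_l * _]mulrA [Phi_l * _]mulrA pentagon_mul.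
by rewrite -mulrA Phi_1V mulr1.
Qed.

Let pentagon_mul1' : Phi_r * PhiV_1 * PhiV_3 = PhiV_2 * PhiV_l.
Proof. by rewrite pentagon_mul1 -mulrA Phi_3V mulr1. Qed.

Let pentagon_mul2 : Phi_1 * PhiV_r = PhiV_3 * Phi_l * Phi_2.
Proof.
by rewrite -[Phi_1]mul1r -PhiV_3K -(mulrA PhiV_3) -pentagon_mul -!mulrA Phi_rV mulr1.
Qed.

Let pentagon_mul3 : PhiV_3 * Phi_l = Phi_1 * PhiV_r * PhiV_2.
Proof. by rewrite pentagon_mul2 -mulrA Phi_2V mulr1. Qed.

Variables (W : lmodType k) (F : H -> H -> H -> H -> W).
Variables (f : R -> W) (fL : linear f).
Hypothesis fE : forall a b c d, f (T a b c d) = F a b c d.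

Lemma pentagon_model1 :
  \tsum_(X1, X2, X3 <- Φ) \tsum_(x1, x2, x3 <- Φ^-1) \tsum_(a, b <- Δ x1)
    F (X1 * a) (X2 * b) (X3 * x2) x3
  = \tsum_(x1, x2, x3 <- Φ^-1) \tsum_(a, b <- Δ x2)
    \tsum_(y1, y2, y3 <- Φ^-1) \tsum_(X1, X2, X3 <- Φ) \tsum_(c, d <- Δ X3)
    F (x1 * X1) (a * y1 * X2) (b * y2 * c) (x3 * y3 * d).
Proof.
transitivity (f (Phi_r * PhiV_1)).
  rewrite (linear_tsum3E _ _ (f := fun s => f (s * _))); last by linear_tac.
  apply: eq_tsum3 => X1 X2 X3.
  rewrite (linear_tsum3E _ _ (f := fun s => f (_ * s))); last by linear_tac.
  apply: eq_tsum3 => x1 x2 x3.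
  rewrite (linear_tsumE _ _ (f := fun s => f (_ * s))); last by linear_tac.
  by apply: eq_tsum => a b; rewrite -!TM fE mul1r.
rewrite pentagon_mul1.
rewrite (linear_tsum3E _ _ (f := fun s => f (s * _ * _))); last by linear_tac.
apply: eq_tsum3 => x1 x2 x3.
rewrite (linear_tsumE _ _ (f := fun s => f (s * _ * _))); last by linear_tac.
apply: eq_tsum => a b.
rewrite (linear_tsum3E _ _ (f := fun s => f (_ * s * _))); last by linear_tac.
apply: eq_tsum3 => y1 y2 y3.
rewrite (linear_tsum3E _ _ (f := fun s => f (_ * s))); last by linear_tac.
apply: eq_tsum3 => X1 X2 X3.
rewrite (linear_tsumE _ _ (f := fun s => f (_ * s))); last by linear_tac.
by apply: eq_tsum => c d; rewrite -!TM fE mulr1.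
Qed.

Lemma pentagon_model1' :
  \tsum_(X1, X2, X3 <- Φ) \tsum_(x1, x2, x3 <- Φ^-1) \tsum_(a, b <- Δ x1)
  \tsum_(y1, y2, y3 <- Φ^-1) \tsum_(c, d <- Δ y3)
    F (X1 * a * y1) (X2 * b * y2) (X3 * x2 * c) (x3 * d)
  = \tsum_(x1, x2, x3 <- Φ^-1) \tsum_(a, b <- Δ x2)
    \tsum_(y1, y2, y3 <- Φ^-1) F x1 (a * y1) (b * y2) (x3 * y3).
Proof.
transitivity (f (Phi_r * PhiV_1 * PhiV_3)).
  rewrite (linear_tsum3E _ _ (f := fun s => f (s * _ * _))); last by linear_tac.
  apply: eq_tsum3 => X1 X2 X3.
  rewrite (linear_tsum3E _ _ (f := fun s => f (_ * s * _))); last by linear_tac.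
  apply: eq_tsum3 => x1 x2 x3.
  rewrite (linear_tsumE _ _ (f := fun s => f (_ * s * _))); last by linear_tac.
  apply: eq_tsum => a b.
  rewrite (linear_tsum3E _ _ (f := fun s => f (_ * s))); last by linear_tac.
  apply: eq_tsum3 => y1 y2 y3.
  rewrite (linear_tsumE _ _ (f := fun s => f (_ * s))); last by linear_tac.
  by apply: eq_tsum => c d; rewrite -!TM fE mul1r.
rewrite pentagon_mul1'.
rewrite (linear_tsum3E _ _ (f := fun s => f (s * _))); last by linear_tac.
apply: eq_tsum3 => x1 x2 x3.
rewrite (linear_tsumE _ _ (f := fun s => f (s * _))); last by linear_tac.
apply: eq_tsum => a b.
rewrite (linear_tsum3E _ _ (f := fun s => f (_ * s))); last by linear_tac.
by apply: eq_tsum3 => y1 y2 y3; rewrite -!TM fE mulr1.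
Qed.

Lemma pentagon_model2 :
  \tsum_(X1, X2, X3 <- Φ) \tsum_(a, b <- Δ X1) \tsum_(x1, x2, x3 <- Φ^-1)
    F (a * x1) (b * x2) (X2 * x3) X3
  = \tsum_(x1, x2, x3 <- Φ^-1) \tsum_(a, b <- Δ x3) \tsum_(Y1, Y2, Y3 <- Φ)
    \tsum_(X1, X2, X3 <- Φ) \tsum_(c, d <- Δ X2)
    F (x1 * X1) (x2 * Y1 * c) (a * Y2 * d) (b * Y3 * X3).
Proof.
transitivity (f (Phi_1 * PhiV_r)).
  rewrite (linear_tsum3E _ _ (f := fun s => f (s * _))); last by linear_tac.
  apply: eq_tsum3 => X1 X2 X3.
  rewrite (linear_tsumE _ _ (f := fun s => f (s * _))); last by linear_tac.
  apply: eq_tsum => a b.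
  rewrite (linear_tsum3E _ _ (f := fun s => f (_ * s))); last by linear_tac.
  by apply: eq_tsum3 => x1 x2 x3; rewrite -!TM fE mulr1.
rewrite pentagon_mul2.
rewrite (linear_tsum3E _ _ (f := fun s => f (s * _ * _))); last by linear_tac.
apply: eq_tsum3 => x1 x2 x3.
rewrite (linear_tsumE _ _ (f := fun s => f (s * _ * _))); last by linear_tac.
apply: eq_tsum => a b.
rewrite (linear_tsum3E _ _ (f := fun s => f (_ * s * _))); last by linear_tac.
apply: eq_tsum3 => Y1 Y2 Y3.
rewrite (linear_tsum3E _ _ (f := fun s => f (_ * s))); last by linear_tac.
apply: eq_tsum3 => X1 X2 X3.
rewrite (linear_tsumE _ _ (f := fun s => f (_ * s))); last by linear_tac.
by apply: eq_tsum => c d; rewrite -!TM fE mulr1.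
Qed.

Lemma pentagon_model3 :
  \tsum_(x1, x2, x3 <- Φ^-1) \tsum_(a, b <- Δ x3) \tsum_(Y1, Y2, Y3 <- Φ)
    F x1 (x2 * Y1) (a * Y2) (b * Y3)
  = \tsum_(Z1, Z2, Z3 <- Φ) \tsum_(a, b <- Δ Z1) \tsum_(z1, z2, z3 <- Φ^-1)
    \tsum_(x1, x2, x3 <- Φ^-1) \tsum_(c, d <- Δ x2)
    F (a * z1 * x1) (b * z2 * c) (Z2 * z3 * d) (Z3 * x3).
Proof.
transitivity (f (PhiV_3 * Phi_l)).
  rewrite (linear_tsum3E _ _ (f := fun s => f (s * _))); last by linear_tac.
  apply: eq_tsum3 => x1 x2 x3.
  rewrite (linear_tsumE _ _ (f := fun s => f (s * _))); last by linear_tac.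
  apply: eq_tsum => a b.
  rewrite (linear_tsum3E _ _ (f := fun s => f (_ * s))); last by linear_tac.
  by apply: eq_tsum3 => Y1 Y2 Y3; rewrite -!TM fE mulr1.
rewrite pentagon_mul3.
rewrite (linear_tsum3E _ _ (f := fun s => f (s * _ * _))); last by linear_tac.
apply: eq_tsum3 => Z1 Z2 Z3.
rewrite (linear_tsumE _ _ (f := fun s => f (s * _ * _))); last by linear_tac.
apply: eq_tsum => a b.
rewrite (linear_tsum3E _ _ (f := fun s => f (_ * s * _))); last by linear_tac.
apply: eq_tsum3 => z1 z2 z3.
rewrite (linear_tsum3E _ _ (f := fun s => f (_ * s))); last by linear_tac.
apply: eq_tsum3 => x1 x2 x3.
rewrite (linear_tsumE _ _ (f := fun s => f (_ * s))); last by linear_tac.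
by apply: eq_tsum => c d; rewrite -!TM fE mulr1.
Qed.

End Consequences.

Lemma pentagon_sum1 (W : lmodType k) (F : H -> H -> H -> H -> W) :
  quadrilinear F ->
  \tsum_(X1, X2, X3 <- Φ) \tsum_(x1, x2, x3 <- Φ^-1) \tsum_(a, b <- Δ x1)
    F (X1 * a) (X2 * b) (X3 * x2) x3
  = \tsum_(x1, x2, x3 <- Φ^-1) \tsum_(a, b <- Δ x2)
    \tsum_(y1, y2, y3 <- Φ^-1) \tsum_(X1, X2, X3 <- Φ) \tsum_(c, d <- Δ X3)
    F (x1 * X1) (a * y1 * X2) (b * y2 * c) (x3 * y3 * d).
Proof.
move=> FQ; have [R [T [TQ TM T1 TP Tev]]] := tensor4_model.
have [f fL fE] := Tev W F FQ; exact: pentagon_model1 fL fE.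
Qed.

Lemma pentagon_sum1' (W : lmodType k) (F : H -> H -> H -> H -> W) :
  quadrilinear F ->
  \tsum_(X1, X2, X3 <- Φ) \tsum_(x1, x2, x3 <- Φ^-1) \tsum_(a, b <- Δ x1)
  \tsum_(y1, y2, y3 <- Φ^-1) \tsum_(c, d <- Δ y3)
    F (X1 * a * y1) (X2 * b * y2) (X3 * x2 * c) (x3 * d)
  = \tsum_(x1, x2, x3 <- Φ^-1) \tsum_(a, b <- Δ x2)
    \tsum_(y1, y2, y3 <- Φ^-1) F x1 (a * y1) (b * y2) (x3 * y3).
Proof.
move=> FQ; have [R [T [TQ TM T1 TP Tev]]] := tensor4_model.
have [f fL fE] := Tev W F FQ; exact: pentagon_model1' fL fE.
Qed.

Lemma pentagon_sum2 (W : lmodType k) (F : H -> H -> H -> H -> W) :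
  quadrilinear F ->
  \tsum_(X1, X2, X3 <- Φ) \tsum_(a, b <- Δ X1) \tsum_(x1, x2, x3 <- Φ^-1)
    F (a * x1) (b * x2) (X2 * x3) X3
  = \tsum_(x1, x2, x3 <- Φ^-1) \tsum_(a, b <- Δ x3) \tsum_(Y1, Y2, Y3 <- Φ)
    \tsum_(X1, X2, X3 <- Φ) \tsum_(c, d <- Δ X2)
    F (x1 * X1) (x2 * Y1 * c) (a * Y2 * d) (b * Y3 * X3).
Proof.
move=> FQ; have [R [T [TQ TM T1 TP Tev]]] := tensor4_model.
have [f fL fE] := Tev W F FQ; exact: pentagon_model2 fL fE.
Qed.

Lemma pentagon_sum3 (W : lmodType k) (F : H -> H -> H -> H -> W) :
  quadrilinear F ->
  \tsum_(x1, x2, x3 <- Φ^-1) \tsum_(a, b <- Δ x3) \tsum_(Y1, Y2, Y3 <- Φ)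
    F x1 (x2 * Y1) (a * Y2) (b * Y3)
  = \tsum_(Z1, Z2, Z3 <- Φ) \tsum_(a, b <- Δ Z1) \tsum_(z1, z2, z3 <- Φ^-1)
    \tsum_(x1, x2, x3 <- Φ^-1) \tsum_(c, d <- Δ x2)
    F (a * z1 * x1) (b * z2 * c) (Z2 * z3 * d) (Z3 * x3).
Proof.
move=> FQ; have [R [T [TQ TM T1 TP Tev]]] := tensor4_model.
have [f fL fE] := Tev W F FQ; exact: pentagon_model3 fL fE.
Qed.

End Pentagon.

(** * Contractions with the antipode *)

Section QuasiHopfSums.
Variables (k : fieldType) (H : quasi_hopf k).
Local Notation "'Φ'" := (reassoc H).
Local Notation "'Φ^-1'" := (reassocV H).
Local Notation Δ := coprod.
Local Notation ε := counit.
Local Notation S := antipode.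
Local Notation α := (qalpha H).
Local Notation β := (qbeta H).

Section Contractions.
Variable W : lmodType k.

Lemma antipode_alpha_sum (L : H -> W) (h : H) : linear L ->
  \tsum_(a, b <- Δ h) L (S a * α * b) = ε h *: L α.
Proof.
by move=> LL; rewrite -(linear_scale LL) -antipode_alpha (linear_tsumE _ _ LL).
Qed.

Lemma antipode_beta_sum (L : H -> W) (h : H) : linear L ->
  \tsum_(a, b <- Δ h) L (a * β * S b) = ε h *: L β.
Proof.
by move=> LL; rewrite -(linear_scale LL) -antipode_beta (linear_tsumE _ _ LL).
Qed.

Lemma reassoc_antipode_sum (L : H -> W) : linear L ->
  \tsum_(X1, X2, X3 <- Φ) L (X1 * β * S X2 * α * X3) = L 1.
Proof.
by move=> LL; rewrite -(reassoc_antipode H) (linear_tsum3E _ _ LL).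
Qed.

Lemma reassocV_antipode_sum (L : H -> W) : linear L ->
  \tsum_(x1, x2, x3 <- Φ^-1) L (S x1 * α * x2 * β * S x3) = L 1.
Proof.
by move=> LL; rewrite -(reassocV_antipode H) (linear_tsum3E _ _ LL).
Qed.

(** Joining the second and third legs of the pentagon by S(·)α(·) brings the two parts of Δ(x^2)
    together around α. They collapse to ε(x^2), and the normalisation of Φ^{-1} removes that copy
    altogether. *)
Lemma pentagon_alpha1 (G : H -> H -> H -> W) : trilinear G ->
  \tsum_(X1, X2, X3 <- Φ) \tsum_(x1, x2, x3 <- Φ^-1) \tsum_(a, b <- Δ x1)
    G (X1 * a) (S (X2 * b) * α * (X3 * x2)) x3
  = \tsum_(y1, y2, y3 <- Φ^-1) \tsum_(X1, X2, X3 <- Φ) \tsum_(c, d <- Δ X3)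
    G X1 (S (y1 * X2) * α * (y2 * c)) (y3 * d).
Proof.
move=> GT; have [G1 G2 G3] := GT.
(* [z] holds the place of S(a)αb, so that the antipode axiom can be applied in the middle of a
   word. *)
pose K (x1 z x3 : H) := \tsum_(y1, y2, y3 <- Φ^-1) \tsum_(X1, X2, X3 <- Φ)
  \tsum_(c, d <- Δ X3) G (x1 * X1) (S (y1 * X2) * z * (y2 * c)) (x3 * y3 * d).
have K1 z x3 : linear (fun x1 => K x1 z x3) by rewrite /K; linear_tac.
have K2 x1 x3 : linear (fun z => K x1 z x3) by rewrite /K; linear_tac.
have K3 x1 z : linear (fun x3 => K x1 z x3) by rewrite /K; linear_tac.
rewrite (pentagon_sum1 (F := fun a b c d => G a (S b * α * c) d)); last first.
  by split; linear_tac.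
transitivity (\tsum_(x1, x2, x3 <- Φ^-1) \tsum_(a, b <- Δ x2)
  K x1 (S a * α * b) x3).
  apply: eq_tsum3 => x1 x2 x3; apply: eq_tsum => a b; rewrite /K.
  apply: eq_tsum3 => y1 y2 y3; apply: eq_tsum3 => X1 X2 X3.
  by apply: eq_tsum => c d; rewrite -!mulrA antipodeM !mulrA.
under eq_tsum3 => x1 x2 x3 do rewrite (antipode_alpha_sum _ (K2 x1 x3)).
rewrite counit_reassocV2_sum; last by linear_tac.
rewrite /K; apply: eq_tsum3 => y1 y2 y3; apply: eq_tsum3 => X1 X2 X3.
by apply: eq_tsum => c d; rewrite !mul1r.
Qed.

(** Here the last two legs are joined by (·)βS(·), and it is the factor (id ⊗ id ⊗ Δ)(Φ) that
    collapses around β. *)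
Lemma pentagon_beta1 (G : H -> H -> H -> W) : trilinear G ->
  \tsum_(X1, X2, X3 <- Φ) \tsum_(x1, x2, x3 <- Φ^-1) \tsum_(a, b <- Δ x1)
    G (X1 * a) (X2 * b) (X3 * x2 * β * S x3)
  = \tsum_(x1, x2, x3 <- Φ^-1) \tsum_(a, b <- Δ x2) \tsum_(y1, y2, y3 <- Φ^-1)
    G x1 (a * y1) (b * y2 * β * S (x3 * y3)).
Proof.
move=> GT; have [G1 G2 G3] := GT.
rewrite (pentagon_sum1 (F := fun a b c d => G a b (c * β * S d))); last first.
  by split; linear_tac.
apply: eq_tsum3 => x1 x2 x3; apply: eq_tsum => a b.
apply: eq_tsum3 => y1 y2 y3.
transitivity (\tsum_(X1, X2, X3 <- Φ) ε X3 *: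
    G (x1 * X1) (a * y1 * X2) (b * y2 * β * S (x3 * y3))).
  apply: eq_tsum3 => X1 X2 X3.
  rewrite -(antipode_beta_sum (L := fun z =>
    G (x1 * X1) (a * y1 * X2) (b * y2 * z * S (x3 * y3)))); last by linear_tac.
  by apply: eq_tsum => c d; rewrite !antipodeM !mulrA.
rewrite (counit_reassoc3_sum (F := fun X1 X2 =>
  G (x1 * X1) (a * y1 * X2) (b * y2 * β * S (x3 * y3)))); last by linear_tac.
by rewrite !mulr1.
Qed.

(** Joining the last two legs by S(·)α(·) eliminates the factor (id ⊗ id ⊗ Δ)(Φ^{-1}). *)
Lemma pentagon_alpha2 (G : H -> H -> H -> W) : trilinear G ->
  \tsum_(X1, X2, X3 <- Φ) \tsum_(a, b <- Δ X1) \tsum_(x1, x2, x3 <- Φ^-1)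
    G (a * x1) (b * x2) (S (X2 * x3) * α * X3)
  = \tsum_(Y1, Y2, Y3 <- Φ) \tsum_(X1, X2, X3 <- Φ) \tsum_(c, d <- Δ X2)
    G X1 (Y1 * c) (S (Y2 * d) * α * (Y3 * X3)).
Proof.
move=> GT; have [G1 G2 G3] := GT.
pose K (x1 x2 z : H) := \tsum_(Y1, Y2, Y3 <- Φ) \tsum_(X1, X2, X3 <- Φ)
  \tsum_(c, d <- Δ X2)
    G (x1 * X1) (x2 * Y1 * c) (S (Y2 * d) * z * (Y3 * X3)).
have K1 x2 z : linear (fun x1 => K x1 x2 z) by rewrite /K; linear_tac.
have K2 x1 z : linear (fun x2 => K x1 x2 z) by rewrite /K; linear_tac.
have K3 x1 x2 : linear (fun z => K x1 x2 z) by rewrite /K; linear_tac.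
rewrite (pentagon_sum2 (F := fun a b c d => G a b (S c * α * d))); last first.
  by split; linear_tac.
transitivity (\tsum_(x1, x2, x3 <- Φ^-1) \tsum_(a, b <- Δ x3)
  K x1 x2 (S a * α * b)).
  apply: eq_tsum3 => x1 x2 x3; apply: eq_tsum => a b; rewrite /K.
  apply: eq_tsum3 => y1 y2 y3; apply: eq_tsum3 => X1 X2 X3.
  by apply: eq_tsum => c d; rewrite !antipodeM !mulrA.
under eq_tsum3 => x1 x2 x3 do rewrite (antipode_alpha_sum _ (K3 x1 x2)).
rewrite (counit_reassocV3_sum (F := fun x1 x2 => K x1 x2 α)); last by linear_tac.
rewrite /K; apply: eq_tsum3 => y1 y2 y3; apply: eq_tsum3 => X1 X2 X3.
by apply: eq_tsum => c d; rewrite !mul1r.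
Qed.

(* The identity Δ(q^1) p_R (1 ⊗ S(q^2)) = 1 ⊗ 1, for
   q_R = X^1 ⊗ S^{-1}(α X^3) X^2 and p_R = x^1 ⊗ x^2 β S(x^3). *)
Lemma qR_pR_sum (G : H -> H -> W) : is_bilinear G ->
  \tsum_(X1, X2, X3 <- Φ) \tsum_(a, b <- Δ X1) \tsum_(x1, x2, x3 <- Φ^-1)
    G (a * x1) (b * x2 * β * (S (X2 * x3) * α * X3)) = G 1 1.
Proof.
move=> GB.
rewrite (pentagon_alpha2 (G := fun a b c => G a (b * β * c))); last first.
  by split; linear_tac.
(* The two parts of X^2 meet around β, so X^2 enters only through ε and the copy X disappears; what
   is left is the antipode axiom for Φ. *)
transitivity (\tsum_(Y1, Y2, Y3 <- Φ) G 1 (Y1 * β * S Y2 * α * Y3)).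
  apply: eq_tsum3 => Y1 Y2 Y3.
  transitivity (\tsum_(X1, X2, X3 <- Φ)
      ε X2 *: G X1 (Y1 * β * S Y2 * α * Y3 * X3)).
    apply: eq_tsum3 => X1 X2 X3.
    rewrite -(antipode_beta_sum (L := fun z =>
      G X1 (Y1 * z * S Y2 * α * Y3 * X3))); last by linear_tac.
    by apply: eq_tsum => c d; rewrite !antipodeM !mulrA.
  rewrite (counit_reassoc2_sum (F := fun X1 X3 =>
    G X1 (Y1 * β * S Y2 * α * Y3 * X3))); last by linear_tac.
  by rewrite mulr1.
by apply: reassoc_antipode_sum; linear_tac.
Qed.

(** The companion identity (1 ⊗ S^{-1}(p^2)) q_R Δ(p^1) = 1 ⊗ 1 for p_R = p^1 ⊗ p^2, with S applied
    to the second leg. It rests on the antipode axiom for Φ^{-1}. *)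
Lemma pR_qR_sum (G : H -> H -> W) : is_bilinear G ->
  \tsum_(X1, X2, X3 <- Φ) \tsum_(x1, x2, x3 <- Φ^-1) \tsum_(a, b <- Δ x1)
    G (X1 * a) (S (X2 * b) * α * (X3 * x2) * β * S x3) = G 1 1.
Proof.
move=> GB.
rewrite (pentagon_alpha1 (G := fun a b c => G a (b * β * S c))); last first.
  by split; linear_tac.
transitivity (\tsum_(y1, y2, y3 <- Φ^-1) G 1 (S y1 * α * y2 * β * S y3)).
  apply: eq_tsum3 => y1 y2 y3.
  transitivity (\tsum_(X1, X2, X3 <- Φ)
      ε X3 *: G X1 (S (y1 * X2) * α * y2 * β * S y3)).
    apply: eq_tsum3 => X1 X2 X3.
    rewrite -(antipode_beta_sum (L := fun z =>
      G X1 (S (y1 * X2) * α * y2 * z * S y3))); last by linear_tac.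
    by apply: eq_tsum => c d; rewrite !antipodeM !mulrA.
  rewrite (counit_reassoc3_sum (F := fun X1 X2 =>
    G X1 (S (y1 * X2) * α * y2 * β * S y3))); last by linear_tac.
  by rewrite mulr1.
by apply: reassocV_antipode_sum; linear_tac.
Qed.

(** Coassociativity moves the second coproduct from h_1 to h_2, whose two parts then surround β and
    collapse. This is the intertwining property Δ(h_1) p_R (1 ⊗ S(h_2)) = p_R (h ⊗ 1). *)
Lemma coprod_pR_sum (G : H -> H -> W) (h : H) : is_bilinear G ->
  \tsum_(h1, h2 <- Δ h) \tsum_(a, b <- Δ h1) \tsum_(x1, x2, x3 <- Φ^-1)
    G (a * x1) (b * x2 * β * S (h2 * x3))
  = \tsum_(x1, x2, x3 <- Φ^-1) G (x1 * h) (x2 * β * S x3).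
Proof.
move=> GB; pose F (a b c : H) := G a (b * β * S c).
have FT : trilinear F by rewrite /F; split; linear_tac.
transitivity (\tsum_(x1, x2, x3 <- Φ^-1) \tsum_(h1, h2 <- Δ h)
    \tsum_(a, b <- Δ h1) F (a * x1) (b * x2) (h2 * x3)).
  rewrite -tsum3_exchange; apply: eq_tsum => h1 h2.
  by rewrite -tsum3_exchange.
rewrite coassocV_sum //; apply: eq_tsum3 => x1 x2 x3.
rewrite -(counit_r_sum (F := fun h => G (x1 * h) (x2 * β * S x3))); last first.
  by linear_tac.
apply: eq_tsum => h1 h2.
rewrite -(antipode_beta_sum (L := fun z => G (x1 * h1) (x2 * z * S x3))).
  by apply: eq_tsum => a b; rewrite /F !antipodeM !mulrA.
by linear_tac.
Qed.

End Contractions.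
End QuasiHopfSums.

(** * The module algebra of an algebra map *)

Section AlgebraAlong.
Variables (k : fieldType) (H : quasi_hopf k).
Local Notation "'Φ'" := (reassoc H).
Local Notation "'Φ^-1'" := (reassocV H).
Local Notation Δ := coprod.
Local Notation ε := counit.
Local Notation S := antipode.
Local Notation α := (qalpha H).
Local Notation β := (qbeta H).

(** The algebra laws of B are hypotheses on a [pre_algebra], so that the results apply to [smash A],
    which carries no ring structure and may be zero. *)
Variables (B : pre_algebra k) (v : H -> B).
Local Notation "b ∙ b'" := (pa_mul B b b') (at level 40, left associativity).
Hypothesis mB : is_bilinear (pa_mul B).
Hypothesis mA : forall b b' b'' : B, b ∙ (b' ∙ b'') = b ∙ b' ∙ b''.
Hypothesis m1l : forall b : B, pa_one B ∙ b = b.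
Hypothesis m1r : forall b : B, b ∙ pa_one B = b.
Hypothesis vL : linear v.
Hypothesis v1 : v 1 = pa_one B.
Hypothesis vM : forall h h', v (h * h') = v h ∙ v h'.

Definition along_act (h : H) (b : B) : B :=
  \tsum_(h1, h2 <- Δ h) v h1 ∙ b ∙ v (S h2).
Definition along_mul : B -> B -> B := pa_mul (algebra_along v).

(* The map b ↦ q^1 b S(q^2): the action of the object B^v on the object B of the
   category of H-modules, written as a left multiplication in B. *)
Definition along_op (b : B) : B :=
  \tsum_(X1, X2, X3 <- Φ) v X1 ∙ b ∙ v (S X2 * α * X3).

Local Notation "h ▷ b" := (along_act h b) (at level 35, right associativity).
Local Notation "b ⋆ b'" := (along_mul b b') (at level 40, left associativity).
Local Notation ψ := along_op.

Lemma along_act_bilinear : is_bilinear along_act.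
Proof. by split=> *; rewrite /along_act; linear_tac. Qed.
Let aB := along_act_bilinear.

Lemma along_op_linear : linear ψ.
Proof. by rewrite /along_op; linear_tac. Qed.
Let ψL := along_op_linear.

Lemma along_act1 b : 1 ▷ b = b.
Proof.
rewrite /along_act coprod1_sum; last by linear_tac.
by rewrite antipode1 v1 m1l m1r.
Qed.

Lemma along_actM h h' b : (h * h') ▷ b = h ▷ h' ▷ b.
Proof.
rewrite /along_act coprodM_sum; last by linear_tac.
apply: eq_tsum => h1 h2.
rewrite (linear_tsumE _ _ (f := fun s => _ ∙ s ∙ _)); last by linear_tac.
by apply: eq_tsum => h1' h2'; rewrite !(antipodeM, vM, mA).
Qed.

Lemma along_op_actE h b :
  ψ (h ▷ b) = \tsum_(X1, X2, X3 <- Φ) \tsum_(h1, h2 <- Δ h)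
                v (X1 * h1) ∙ b ∙ v (S (X2 * h2) * α * X3).
Proof.
apply: eq_tsum3 => X1 X2 X3.
rewrite (linear_tsumE _ _ (f := fun s => _ ∙ s ∙ _)); last by linear_tac.
by apply: eq_tsum => h1 h2; rewrite !(antipodeM, vM, mA).
Qed.

(** After coassociativity the two parts of h_2 stand on either side of α and collapse. *)
Lemma along_op_equivariant h b :
  v h ∙ ψ b = \tsum_(h1, h2 <- Δ h) ψ (h1 ▷ b) ∙ v h2.
Proof.
pose F (x y z : H) := v x ∙ b ∙ v (S y * α * z).
have FT : trilinear F by rewrite /F; split; linear_tac.
transitivity (\tsum_(X1, X2, X3 <- Φ) \tsum_(h1, h2 <- Δ h)
    \tsum_(x, y <- Δ h1) F (X1 * x) (X2 * y) (X3 * h2)); last first.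
  rewrite -tsum3_exchange; apply: eq_tsum => h1 h2; rewrite along_op_actE.
  rewrite (linear_tsum3E _ _ (f := fun s => s ∙ _)); last by linear_tac.
  apply: eq_tsum3 => X1 X2 X3.
  rewrite (linear_tsumE _ _ (f := fun s => s ∙ _)); last by linear_tac.
  by apply: eq_tsum => x y; rewrite /F !(vM, mA).
rewrite coassoc_sum // /along_op.
rewrite (linear_tsum3E _ _ (f := fun s => _ ∙ s)); last by linear_tac.
apply: eq_tsum3 => X1 X2 X3.
transitivity (v (h * X1) ∙ b ∙ v (S X2 * α * X3)); first by rewrite !(vM, mA).
rewrite -(counit_r_sum (F := fun h => v (h * X1) ∙ b ∙ v (S X2 * α * X3)) h);
  last by linear_tac.
apply: eq_tsum => h1 h2.
rewrite -(antipode_alpha_sum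
  (L := fun z => v (h1 * X1) ∙ b ∙ v (S X2 * z * X3))); last by linear_tac.
by apply: eq_tsum => x y; rewrite /F !(antipodeM, vM, mA).
Qed.

(** [pR_qR_sum] with its two legs placed on the two sides of b. It recovers b from ψ and supplies
    the right unit law. *)
Lemma along_op_inv b :
  \tsum_(x1, x2, x3 <- Φ^-1) ψ (x1 ▷ b) ∙ v (x2 * β * S x3) = b.
Proof.
rewrite -[RHS](_ : v 1 ∙ b ∙ v 1 = b); last by rewrite v1 m1l m1r.
rewrite -(pR_qR_sum (G := fun x y => v x ∙ b ∙ v y)); last by linear_tac.
rewrite tsum33_exchange; apply: eq_tsum3 => x1 x2 x3.
rewrite along_op_actE.
rewrite (linear_tsum3E _ _ (f := fun s => s ∙ _)); last by linear_tac.
apply: eq_tsum3 => X1 X2 X3.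
rewrite (linear_tsumE _ _ (f := fun s => s ∙ _)); last by linear_tac.
by apply: eq_tsum => x y; rewrite !(vM, mA).
Qed.

Lemma along_mul_def b b' :
  b ⋆ b' = \tsum_(X1, X2, X3 <- Φ) \tsum_(x1, x2, x3 <- Φ^-1)
    \tsum_(c, d <- Δ X3)
      v X1 ∙ b ∙ v (S (x1 * X2) * α * x2 * c) ∙ b' ∙ v (S (x3 * d)).
Proof. by []. Qed.

(** The definition of ⋆ carries Δ on the third leg of Φ, while ψ(x^1 ▷ b) carries it on the first
    leg of Φ^{-1}; [pentagon_alpha1] exchanges the two forms. *)
Lemma along_mulE b b' :
  b ⋆ b' = \tsum_(x1, x2, x3 <- Φ^-1) ψ (x1 ▷ b) ∙ v x2 ∙ b' ∙ v (S x3).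
Proof.
pose G (x y z : H) := v x ∙ b ∙ v y ∙ b' ∙ v (S z).
have GT : trilinear G by rewrite /G; split; linear_tac.
transitivity (\tsum_(x1, x2, x3 <- Φ^-1) \tsum_(X1, X2, X3 <- Φ)
    \tsum_(c, d <- Δ X3) G X1 (S (x1 * X2) * α * (x2 * c)) (x3 * d)).
  rewrite tsum33_exchange along_mul_def; apply: eq_tsum3 => X1 X2 X3.
  apply: eq_tsum3 => x1 x2 x3; apply: eq_tsum => c d.
  by rewrite /G !(antipodeM, vM, mA).
rewrite -pentagon_alpha1 // tsum33_exchange; apply: eq_tsum3 => x1 x2 x3.
rewrite along_op_actE.
rewrite (linear_tsum3E _ _ (f := fun s => s ∙ _ ∙ _ ∙ _)); last by linear_tac.
apply: eq_tsum3 => X1 X2 X3.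
rewrite (linear_tsumE _ _ (f := fun s => s ∙ _ ∙ _ ∙ _)); last by linear_tac.
by apply: eq_tsum => c d; rewrite /G !(vM, mA).
Qed.

Lemma along_mul_bilinear : is_bilinear along_mul.
Proof.
split=> b c x y; rewrite !along_mulE.
  have fL : linear (fun s =>
    \tsum_(x1, x2, x3 <- Φ^-1) ψ (x1 ▷ s) ∙ v x2 ∙ b ∙ v (S x3)) by linear_tac.
  exact: fL.
have fL : linear (fun s =>
  \tsum_(x1, x2, x3 <- Φ^-1) ψ (x1 ▷ b) ∙ v x2 ∙ s ∙ v (S x3)) by linear_tac.
exact: fL.
Qed.
Let sB := along_mul_bilinear.

(** Moving v(X^1) through ψ by equivariance produces exactly the left side of [pentagon_alpha2]; its
    right side contains the ψ of the second factor. *)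
Lemma along_op_mul b b' :
  ψ (b ⋆ b') = \tsum_(X1, X2, X3 <- Φ) ψ (X1 ▷ b) ∙ ψ (X2 ▷ b') ∙ v X3.
Proof.
pose G (x y z : H) := ψ (x ▷ b) ∙ v y ∙ b' ∙ v z.
have GT : trilinear G by rewrite /G; split; linear_tac.
transitivity (\tsum_(X1, X2, X3 <- Φ) \tsum_(x, y <- Δ X1)
    \tsum_(x1, x2, x3 <- Φ^-1) G (x * x1) (y * x2) (S (X2 * x3) * α * X3)).
  apply: eq_tsum3 => X1 X2 X3; rewrite along_mulE tsum3_exchange.
  rewrite (linear_tsum3E _ _ (f := fun s => _ ∙ s ∙ _)); last by linear_tac.
  apply: eq_tsum3 => x1 x2 x3; rewrite !mA along_op_equivariant.
  rewrite (linear_tsumE _ _ (f := fun s => s ∙ _ ∙ _ ∙ _ ∙ _));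
    last by linear_tac.
  by apply: eq_tsum => x y; rewrite /G along_actM !(antipodeM, vM, mA).
rewrite pentagon_alpha2 // tsum33_exchange; apply: eq_tsum3 => X1 X2 X3.
rewrite [ψ (X2 ▷ _)]along_op_actE.
rewrite (linear_tsum3E _ _ (f := fun s => _ ∙ s ∙ _)); last by linear_tac.
apply: eq_tsum3 => Y1 Y2 Y3.
rewrite (linear_tsumE _ _ (f := fun s => _ ∙ s ∙ _)); last by linear_tac.
by apply: eq_tsum => x y; rewrite /G !(vM, mA).
Qed.

Lemma along_act_mul h b b' :
  h ▷ (b ⋆ b') = \tsum_(h1, h2 <- Δ h) (h1 ▷ b) ⋆ (h2 ▷ b').
Proof.
pose F (x y z : H) := ψ (x ▷ b) ∙ v y ∙ b' ∙ v (S z).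
have FT : trilinear F by rewrite /F; split; linear_tac.
transitivity (\tsum_(x1, x2, x3 <- Φ^-1) \tsum_(h1, h2 <- Δ h)
    \tsum_(x, y <- Δ h1) F (x * x1) (y * x2) (h2 * x3)).
  rewrite -tsum3_exchange; apply: eq_tsum => h1 h2; rewrite along_mulE.
  rewrite (linear_tsum3E _ _ (f := fun s => _ ∙ s ∙ _)); last by linear_tac.
  apply: eq_tsum3 => x1 x2 x3; rewrite !mA along_op_equivariant.
  rewrite (linear_tsumE _ _ (f := fun s => s ∙ _ ∙ _ ∙ _ ∙ _));
    last by linear_tac.
  by apply: eq_tsum => x y; rewrite /F along_actM !(antipodeM, vM, mA).
rewrite coassocV_sum // -tsum3_exchange; apply: eq_tsum => h1 h2.
rewrite along_mulE; apply: eq_tsum3 => x1 x2 x3.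
rewrite (linear_tsumE _ _ (f := fun s => _ ∙ s ∙ _)); last by linear_tac.
by apply: eq_tsum => x y; rewrite /F along_actM !(antipodeM, vM, mA).
Qed.

Lemma along_act_one h : h ▷ v β = ε h *: v β.
Proof.
rewrite -(antipode_beta_sum (L := v)) //; apply: eq_tsum => h1 h2.
by rewrite !vM.
Qed.

Lemma along_op_one : ψ (v β) = pa_one B.
Proof.
rewrite -v1 -(reassoc_antipode_sum (L := v)) //; apply: eq_tsum3 => X1 X2 X3.
by rewrite !(vM, mA).
Qed.

Lemma along_mul1l b : v β ⋆ b = b.
Proof.
rewrite along_mulE.
transitivity (\tsum_(x1, x2, x3 <- Φ^-1) ε x1 *: (v x2 ∙ b ∙ v (S x3))).
  apply: eq_tsum3 => x1 x2 x3; rewrite along_act_one (linear_scale ψL).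
  rewrite along_op_one.
  rewrite (linear_scale (f := fun s => s ∙ _ ∙ _ ∙ _)) ?m1l //; linear_tac.
rewrite (counit_reassocV1_sum (F := fun x2 x3 => v x2 ∙ b ∙ v (S x3))).
  by rewrite antipode1 v1 m1l m1r.
by linear_tac.
Qed.

Lemma along_mul1r b : b ⋆ v β = b.
Proof.
rewrite along_mulE -[RHS]along_op_inv; apply: eq_tsum3 => x1 x2 x3.
by rewrite !(vM, mA).
Qed.

(** Both sides are brought to the shape ψ(x ▷ b) ψ(y ▷ b') v(z) b'' v(S(w)). They then differ by the
    pentagon itself, evaluated on x ⊗ y ⊗ z ⊗ w without any contraction. *)
Lemma along_mulA b b' b'' :
  b ⋆ b' ⋆ b''
  = \tsum_(X1, X2, X3 <- Φ) (X1 ▷ b) ⋆ ((X2 ▷ b') ⋆ (X3 ▷ b'')).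
Proof.
pose F (x y z w : H) := ψ (x ▷ b) ∙ ψ (y ▷ b') ∙ v z ∙ b'' ∙ v (S w).
have FQ : quadrilinear F by rewrite /F; split; linear_tac.
transitivity (\tsum_(X1, X2, X3 <- Φ) \tsum_(x1, x2, x3 <- Φ^-1)
    \tsum_(x, y <- Δ x1) F (X1 * x) (X2 * y) (X3 * x2) x3).
  rewrite tsum33_exchange along_mulE; apply: eq_tsum3 => x1 x2 x3.
  rewrite along_act_mul (linear_tsumE _ _ ψL).
  rewrite (linear_tsumE _ _ (f := fun s => s ∙ _ ∙ _ ∙ _)); last by linear_tac.
  rewrite -tsum3_exchange; apply: eq_tsum => x y; rewrite along_op_mul.
  rewrite (linear_tsum3E _ _ (f := fun s => s ∙ _ ∙ _ ∙ _)); last by linear_tac.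
  by apply: eq_tsum3 => X1 X2 X3; rewrite /F !along_actM !(antipodeM, vM, mA).
rewrite pentagon_sum1 //.
transitivity (\tsum_(X1, X2, X3 <- Φ) \tsum_(x1, x2, x3 <- Φ^-1)
    \tsum_(y1, y2, y3 <- Φ^-1) \tsum_(x, y <- Δ x2) \tsum_(c, d <- Δ X3)
      F (x1 * X1) (x * y1 * X2) (y * y2 * c) (x3 * y3 * d)).
  rewrite [RHS]tsum33_exchange; apply: eq_tsum3 => x1 x2 x3.
  rewrite [RHS]tsum33_exchange tsum3_exchange; apply: eq_tsum3 => y1 y2 y3.
  by rewrite tsum3_exchange.
apply: eq_tsum3 => X1 X2 X3; rewrite along_mulE; apply: eq_tsum3 => x1 x2 x3.
rewrite along_mulE.
rewrite (linear_tsum3E _ _ (f := fun s => _ ∙ s ∙ _)); last by linear_tac.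
apply: eq_tsum3 => y1 y2 y3.
rewrite !mA -[ψ _ ∙ v x2 ∙ ψ _]mA along_op_equivariant.
rewrite (linear_tsumE _ _ (f := fun s => _ ∙ s ∙ _ ∙ _ ∙ _ ∙ _)); last by linear_tac.
apply: eq_tsum => x y.
rewrite (linear_tsumE _ _ (f := fun s => _ ∙ s ∙ _ ∙ _)); last by linear_tac.
by apply: eq_tsum => c d; rewrite /F !along_actM !(antipodeM, vM, mA).
Qed.

Lemma algebra_along_is_module_algebra :
  is_module_algebra (algebra_along v).
Proof.
split.
- exact: along_act_bilinear.
- exact: along_act1.
- exact: along_actM.
- exact: along_mul_bilinear.
- exact: along_mul1l.
- exact: along_mul1r.
- exact: along_mulA.
- exact: along_act_mul.
- exact: along_act_one.
Qed.

End AlgebraAlong.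

(** * The smash product *)

Section SmashProduct.
Variables (k : fieldType) (H : quasi_hopf k) (A : module_algebra H).
Local Notation "'Φ'" := (reassoc H).
Local Notation "'Φ^-1'" := (reassocV H).
Local Notation Δ := coprod.
Local Notation ε := counit.
Local Notation "a ∙ a'" := (pa_mul A a a') (at level 40, left associativity).
Local Notation "h · a" := (pma_act A h a) (at level 35, right associativity).

Let actB : is_bilinear (pma_act A). Proof. exact: ma_act_bilinear (ma_axioms A). Qed.
Let mulB : is_bilinear (pa_mul A). Proof. exact: ma_mul_bilinear (ma_axioms A). Qed.
Let act1 a : 1 · a = a. Proof. exact: ma_act1 (ma_axioms A) _. Qed.
Let actM h h' a : (h * h') · a = h · h' · a.
Proof. exact: ma_actM (ma_axioms A) _ _ _. Qed.

Definition smash_mul (s t : A ⊗ H) : A ⊗ H := pa_mul (smash A) s t.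
Local Notation "s ⊙ t" := (smash_mul s t) (at level 40, left associativity).

Lemma smash_mul_bilinear : is_bilinear smash_mul.
Proof.
have fB : is_bilinear (fun s t : A ⊗ H =>
  \tsum_(a, h <- s) \tsum_(a', h' <- t)
      \tsum_(x1, x2, x3 <- Φ^-1) \tsum_(h1, h2 <- Δ h)
        (x1 · a) ∙ ((x2 * h1) · a') ⊗ x3 * h2 * h') by linear_tac.
exact: fB.
Qed.
Let smB := smash_mul_bilinear.

Lemma smash_mul_tens a h a' h' :
  (a ⊗ h) ⊙ (a' ⊗ h')
  = \tsum_(x1, x2, x3 <- Φ^-1) \tsum_(h1, h2 <- Δ h)
        (x1 · a) ∙ ((x2 * h1) · a') ⊗ x3 * h2 * h'.
Proof. by rewrite /smash_mul /= !tsum_tens //; linear_tac. Qed.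

Lemma smash_mul1_tens a a' h' :
  (a ⊗ 1) ⊙ (a' ⊗ h')
  = \tsum_(x1, x2, x3 <- Φ^-1) (x1 · a) ∙ (x2 · a') ⊗ x3 * h'.
Proof.
rewrite smash_mul_tens; apply: eq_tsum3 => x1 x2 x3.
by rewrite coprod1_sum ?mulr1 //; linear_tac.
Qed.

(* The left action of H on A # H by left multiplication by 1 # h. *)
Definition smash_act (h : H) (t : A ⊗ H) : A ⊗ H :=
  \tsum_(a', h' <- t) \tsum_(h1, h2 <- Δ h) (h1 · a') ⊗ h2 * h'.

Lemma smash_act_bilinear : is_bilinear smash_act.
Proof. by split=> *; rewrite /smash_act; linear_tac. Qed.
Let saB := smash_act_bilinear.

Lemma smash_act_tens h a' h' :
  smash_act h (a' ⊗ h') = \tsum_(h1, h2 <- Δ h) (h1 · a') ⊗ h2 * h'.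
Proof. by rewrite /smash_act tsum_tens //; linear_tac. Qed.

(** This factors a # h as (a # 1)(1 # h) and splits associativity into two cases: a left factor 1 #
    h needs coassociativity, a left factor a # 1 needs the pentagon. *)
Lemma smash_mul_act a h t : (a ⊗ h) ⊙ t = (a ⊗ 1) ⊙ smash_act h t.
Proof.
move: t; apply: tensor_ext => [||a' h']; try by linear_tac.
rewrite smash_mul_tens smash_act_tens.
rewrite (linear_tsumE _ _ (f := fun s => _ ⊙ s)); last by linear_tac.
rewrite -tsum3_exchange; apply: eq_tsum => h1 h2; rewrite smash_mul1_tens.
by apply: eq_tsum3 => x1 x2 x3; rewrite actM mulrA.
Qed.

Lemma smash_act_mul h s t : smash_act h (s ⊙ t) = smash_act h s ⊙ t.
Proof.
move: s; apply: tensor_ext => [||a b]; try by linear_tac.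
move: t; apply: tensor_ext => [||a' b']; try by linear_tac.
rewrite smash_mul_tens.
rewrite (linear_tsum3E _ _ (f := fun s => smash_act h s)); last by linear_tac.
transitivity (\tsum_(b1, b2 <- Δ b) \tsum_(x1, x2, x3 <- Φ^-1)
  \tsum_(h1, h2 <- Δ h) \tsum_(c, d <- Δ h1)
    ((c * x1) · a) ∙ ((d * x2) · b1 · a') ⊗ h2 * x3 * b2 * b').
  rewrite tsum3_exchange; apply: eq_tsum3 => x1 x2 x3.
  rewrite (linear_tsumE _ _ (f := fun s => smash_act h s)); last by linear_tac.
  apply: eq_tsum => b1 b2; rewrite smash_act_tens; apply: eq_tsum => h1 h2.
  rewrite (ma_act_mul (ma_axioms A)).
  rewrite (linear_tsumE _ _ (f := fun s => s ⊗ _)); last by linear_tac.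
  by apply: eq_tsum => c d; rewrite !actM !mulrA.
rewrite smash_act_tens.
rewrite (linear_tsumE _ _ (f := fun s => s ⊙ _)); last by linear_tac.
transitivity (\tsum_(b1, b2 <- Δ b) \tsum_(x1, x2, x3 <- Φ^-1)
  \tsum_(h1, h2 <- Δ h) \tsum_(c, d <- Δ h2)
    ((x1 * h1) · a) ∙ ((x2 * c) · b1 · a') ⊗ x3 * d * b2 * b').
  apply: eq_tsum => b1 b2.
  apply: (coassocV_sum
    (F := fun x y z => (x · a) ∙ (y · b1 · a') ⊗ z * b2 * b')).
  by split; linear_tac.
rewrite tsum3_exchange.
under eq_tsum3 => x1 x2 x3 do rewrite tsum_exchange.
rewrite -tsum3_exchange; apply: eq_tsum => h1 h2.
rewrite smash_mul_tens; apply: eq_tsum3 => x1 x2 x3.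
rewrite coprodM_sum; last by linear_tac.
rewrite tsum_exchange; apply: eq_tsum => c d; apply: eq_tsum => b1 b2.
by rewrite !actM !mulrA.
Qed.

Let smash_mul1A a t u : (a ⊗ 1) ⊙ (t ⊙ u) = (a ⊗ 1) ⊙ t ⊙ u.
Proof.
move: t; apply: tensor_ext => [||a' h']; try by linear_tac.
move: u; apply: tensor_ext => [||a'' h'']; try by linear_tac.
rewrite smash_mul_tens smash_mul1_tens.
pose F c d (p q r s : H) := (p · a) ∙ ((q · a') ∙ (r · c · a'')) ⊗ s * d * h''.
have FQ c d : quadrilinear (F c d) by rewrite /F; split; linear_tac.
transitivity (\tsum_(c, d <- Δ h') \tsum_(x1, x2, x3 <- Φ^-1)
  \tsum_(p, q <- Δ x2) \tsum_(y1, y2, y3 <- Φ^-1)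
    F c d x1 (p * y1) (q * y2) (x3 * y3)).
  rewrite (linear_tsum3E _ _ (f := fun s => _ ⊙ s)); last by linear_tac.
  under [RHS]eq_tsum => c d.
    under eq_tsum3 => x1 x2 x3 do rewrite tsum3_exchange.
    rewrite tsum33_exchange.
    over.
  rewrite tsum3_exchange; apply: eq_tsum3 => y1 y2 y3.
  rewrite (linear_tsumE _ _ (f := fun s => _ ⊙ s)); last by linear_tac.
  apply: eq_tsum => c d; rewrite smash_mul1_tens; apply: eq_tsum3 => x1 x2 x3.
  rewrite (ma_act_mul (ma_axioms A)).
  rewrite (linear_tsumE _ _ (f := fun s => _ ∙ s ⊗ _)); last by linear_tac.
  by apply: eq_tsum => p q; rewrite /F !actM !mulrA.
(* On the side now produced, the two copies of Φ^{-1} come from the two smash products and Φ from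
   the associativity law of A. *)
under eq_tsum => c d do rewrite -pentagon_sum1' //.
rewrite (linear_tsum3E _ _ (f := fun s => s ⊙ _)); last by linear_tac.
under eq_tsum => c d.
  under eq_tsum3 => X1 X2 X3.
    under eq_tsum3 => x1 x2 x3 do rewrite tsum3_exchange.
    rewrite tsum33_exchange.
    over.
  rewrite tsum33_exchange.
  over.
rewrite tsum3_exchange; apply: eq_tsum3 => y1 y2 y3; rewrite smash_mul_tens.
under eq_tsum => c d do rewrite tsum33_exchange.
rewrite tsum3_exchange; apply: eq_tsum3 => x1 x2 x3.
rewrite coprodM_sum; last by linear_tac.
rewrite [RHS]tsum_exchange; apply: eq_tsum => c d.
under eq_tsum3 => X1 X2 X3 do rewrite tsum_exchange.
rewrite -tsum3_exchange; apply: eq_tsum => p q.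
rewrite (ma_act_mul (ma_axioms A)).
rewrite (linear_tsumE _ _ (f := fun s => s ∙ _ ⊗ _)); last by linear_tac.
rewrite -tsum3_exchange; apply: eq_tsum => r s.
rewrite (ma_mulA (ma_axioms A)).
rewrite (linear_tsum3E _ _ (f := fun s => s ⊗ _)); last by linear_tac.
by apply: eq_tsum3 => X1 X2 X3; rewrite /F !actM !mulrA.
Qed.

Lemma smash_mulA s t u : s ⊙ (t ⊙ u) = s ⊙ t ⊙ u.
Proof.
move: s; apply: tensor_ext => [||a h]; try by linear_tac.
by rewrite smash_mul_act [(a ⊗ h) ⊙ t]smash_mul_act smash_act_mul smash_mul1A.
Qed.

Lemma smash_mul1_act h t : (pa_one A ⊗ h) ⊙ t = smash_act h t.
Proof.
rewrite smash_mul_act; move: (smash_act h t) => {}t.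
move: t; apply: tensor_ext => [||a' h']; try by linear_tac.
rewrite smash_mul1_tens.
transitivity (\tsum_(x1, x2, x3 <- Φ^-1) ε x1 *: ((x2 · a') ⊗ x3 * h')).
  apply: eq_tsum3 => x1 x2 x3; rewrite (ma_act_one (ma_axioms A)).
  rewrite (linear_scale (f := fun s => s ∙ _ ⊗ _)); last by linear_tac.
  by rewrite (ma_mul1l (ma_axioms A)).
rewrite (counit_reassocV1_sum (F := fun x2 x3 => (x2 · a') ⊗ x3 * h')).
  by rewrite act1 mul1r.
by linear_tac.
Qed.

Lemma smash_mul1l t : (pa_one A ⊗ 1) ⊙ t = t.
Proof.
rewrite smash_mul1_act; move: t; apply: tensor_ext => [||a' h'].
- by linear_tac.
- exact: linear_ident.
rewrite smash_act_tens coprod1_sum; last by linear_tac.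
by rewrite act1 mul1r.
Qed.

Lemma smash_mul_one_r a h h' : (a ⊗ h) ⊙ (pa_one A ⊗ h') = a ⊗ h * h'.
Proof.
rewrite smash_mul_tens.
transitivity (\tsum_(x1, x2, x3 <- Φ^-1) ε x2 *: ((x1 · a) ⊗ x3 * h * h')).
  apply: eq_tsum3 => x1 x2 x3.
  rewrite -(counit_l_sum (F := fun h => ε x2 *: ((x1 · a) ⊗ x3 * h * h')) h);
    last by linear_tac.
  apply: eq_tsum => h1 h2; rewrite (ma_act_one (ma_axioms A)).
  rewrite (linear_scale (f := fun s => _ ∙ s ⊗ _)); last by linear_tac.
  by rewrite (ma_mul1r (ma_axioms A)) rmorphM scalerA mulrC.
rewrite (counit_reassocV2_sum (F := fun x1 x3 => (x1 · a) ⊗ x3 * h * h')).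
  by rewrite act1 mul1r.
by linear_tac.
Qed.

Lemma smash_mul1r t : t ⊙ (pa_one A ⊗ 1) = t.
Proof.
move: t; apply: tensor_ext => [||a' h'].
- by linear_tac.
- exact: linear_ident.
by rewrite smash_mul_one_r mulr1.
Qed.

(** This and [smash_mul_embed] have the shape of the rules for v(h) ψ(b) and ψ(b ⋆ b'), in
    accordance with a # 1 = ψ(ι(a)). *)
Lemma smash_mul_commute h a :
  (pa_one A ⊗ h) ⊙ (a ⊗ 1)
  = \tsum_(h1, h2 <- Δ h) ((h1 · a) ⊗ 1) ⊙ (pa_one A ⊗ h2).
Proof.
rewrite smash_mul1_act smash_act_tens; apply: eq_tsum => h1 h2.
by rewrite smash_mul_one_r mul1r mulr1.
Qed.

Lemma smash_mul_embed a a' :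
  (a ∙ a') ⊗ 1
  = \tsum_(X1, X2, X3 <- Φ)
      ((X1 · a) ⊗ 1) ⊙ ((X2 · a') ⊗ 1) ⊙ (pa_one A ⊗ X3).
Proof.
pose F (p q r : H) := (p · a) ∙ (q · a') ⊗ r.
have FT : trilinear F by rewrite /F; split; linear_tac.
transitivity (F 1 1 1); first by rewrite /F !act1.
rewrite -reassoc_Vmul_sum // tsum33_exchange; apply: eq_tsum3 => X1 X2 X3.
rewrite smash_mul1_tens.
rewrite (linear_tsum3E _ _ (f := fun s => s ⊙ _)); last by linear_tac.
apply: eq_tsum3 => x1 x2 x3.
by rewrite smash_mul_one_r mulr1 /F !actM.
Qed.

End SmashProduct.

(** * The inverse of the Drinfeld twist *)

Section DrinfeldTwist.
Variables (k : fieldType) (H : quasi_hopf k).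
Local Notation "'Φ'" := (reassoc H).
Local Notation "'Φ^-1'" := (reassocV H).
Local Notation Δ := coprod.
Local Notation ε := counit.
Local Notation S := antipode.
Local Notation α := (qalpha H).
Local Notation β := (qbeta H).

Definition p_R : H ⊗ H := \tsum_(x1, x2, x3 <- Φ^-1) x1 ⊗ x2 * β * S x3.

(* It will turn out to be f^{-1} multiplied on the right by
   S(q^2) ⊗ S(q^1), see drinfeld_twistV_qR. *)
Definition twist_qR : H ⊗ H :=
  \tsum_(x1, x2, x3 <- Φ^-1) Δ (S x1 * α * x2) * p_R * (1 ⊗ S x3).

Lemma coprod_sum (h : H) : Δ h = \tsum_(a, b <- Δ h) a ⊗ b.
Proof. exact: (linear_tsum (@linear_ident _ _)). Qed.

Lemma coprod_pR (h : H) :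
  \tsum_(h1, h2 <- Δ h) Δ h1 * p_R * (1 ⊗ S h2) = p_R * (h ⊗ 1).
Proof.
transitivity (\tsum_(x1, x2, x3 <- Φ^-1) (x1 * h) ⊗ (x2 * β * S x3)).
  rewrite -(coprod_pR_sum (G := fun x y => x ⊗ y)); last by linear_tac.
  apply: eq_tsum => h1 h2.
  rewrite {1}coprod_sum.
  rewrite (linear_tsumE _ _ (f := fun s => s * _ * _)); last by linear_tac.
  apply: eq_tsum => a b.
  rewrite (linear_tsum3E _ _ (f := fun s => _ * s * _)); last by linear_tac.
  by apply: eq_tsum3 => x1 x2 x3; rewrite !tensM mulr1 antipodeM !mulrA.
rewrite mul_tsum3l; apply: eq_tsum3 => x1 x2 x3.
by rewrite tensM mulr1.
Qed.

(** Write h = ε(h_1) h_2 and expand ε(h_1) α by the antipode axiom. Coassociativity then leaves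
    S(h_1) on the far left and both parts of h_2 around p_R, where [coprod_pR] merges them. *)
Lemma twist_qR_mul (h : H) :
  twist_qR * (1 ⊗ S h)
  = \tsum_(h1, h2 <- Δ h) Δ (S h1) * twist_qR * (h2 ⊗ 1).
Proof.
pose Q (a b c : H) := Δ (S a * α * b) * p_R * (1 ⊗ S c).
have QT : trilinear Q by rewrite /Q; split; linear_tac.
transitivity (\tsum_(x1, x2, x3 <- Φ^-1) \tsum_(h1, h2 <- Δ h)
    \tsum_(a, b <- Δ h1) Q (a * x1) (b * x2) (h2 * x3)).
  rewrite mul_tsum3l; apply: eq_tsum3 => x1 x2 x3.
  transitivity (Q x1 x2 (h * x3)).
    by rewrite /Q antipodeM -!mulrA tensM mulr1.
  rewrite -(counit_l_sum (F := fun h => Q x1 x2 (h * x3)) h); last first.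
    by rewrite /Q; linear_tac.
  apply: eq_tsum => h1 h2.
  rewrite -(antipode_alpha_sum (L := fun z =>
    Δ (S x1 * z * x2) * p_R * (1 ⊗ S (h2 * x3)))); last by linear_tac.
  by apply: eq_tsum => a b; rewrite /Q !antipodeM !mulrA.
rewrite coassocV_sum // -tsum3_exchange; apply: eq_tsum => h1 h2.
rewrite (linear_tsum3E _ _ (f := fun s => _ * s * _)); last by linear_tac.
  apply: eq_tsum3 => x1 x2 x3.
transitivity (Δ (S h1) * Δ (S x1 * α * x2) * (p_R * (h2 ⊗ 1)) * (1 ⊗ S x3)).
  rewrite -coprod_pR.
  rewrite (linear_tsumE _ _ (f := fun s => _ * s * _)); last by linear_tac.
  apply: eq_tsum => a b.
  by rewrite /Q !antipodeM -(mulr1 (1 : H)) -tensM mulr1 !rmorphM /= !mulrA.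
by rewrite -!mulrA !tensM !mulr1 !mul1r.
Qed.

(** In δ the element β stands between the second and third legs of B, so the factor Φ^{-1} ⊗ 1 of B
    contributes exactly x^1 ⊗ x^2 β S(x^3). *)
Lemma twist_deltaE :
  twist_delta H
  = \tsum_(X1, X2, X3 <- Φ) Δ X1 * p_R * ((β * S X3) ⊗ S X2).
Proof.
pose F (a b c d : H) := a * β * S d ⊗ b * β * S c.
have FQ : quadrilinear F by rewrite /F; split; linear_tac.
have [F1 F2 F3 F4] := FQ.
rewrite /twist_delta mul_tsum3l (linear_tsum3E _ _ (tsum4_linear FQ)).
apply: eq_tsum3 => X1 X2 X3; rewrite tensM tsum_tens; last by linear_tac.
rewrite tsum3_mul; last by split; linear_tac.
rewrite tsum_tens; last by linear_tac.
rewrite {2}coprod_sum.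
rewrite (linear_tsumE _ _ (f := fun s => s * _ * _)); last by linear_tac.
apply: eq_tsum => a b.
rewrite (linear_tsum3E _ _ (f := fun s => _ * s * _)); last by linear_tac.
apply: eq_tsum3 => x1 x2 x3.
by rewrite !tensM /F mulr1 antipodeM !mulrA.
Qed.

(** Substituting the formula for δ puts (id ⊗ id ⊗ Δ)(Φ^{-1})(1 ⊗ Φ) inside f^{-1}. In the pentagon
    expansion of this product the parts of Δ(Z^1) meet around α, which removes the copy Z of Φ;
    [coprod_pR] absorbs the remaining coproduct. *)
Lemma drinfeld_twistVE :
  drinfeld_twistV H
  = \tsum_(x1, x2, x3 <- Φ^-1) Δ (S x1) * twist_qR * ((x2 * β * S x3) ⊗ 1).
Proof.
pose Q (a b c d : H) := Δ (S a * α * b) * p_R * ((β * S d) ⊗ S c).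
have QQ : quadrilinear Q by rewrite /Q; split; linear_tac.
transitivity (\tsum_(x1, x2, x3 <- Φ^-1) \tsum_(a, b <- Δ x3)
    \tsum_(Y1, Y2, Y3 <- Φ) Q x1 (x2 * Y1) (a * Y2) (b * Y3)).
  apply: eq_tsum3 => x1 x2 x3; rewrite mul_tsumr; apply: eq_tsum => a b.
  rewrite twist_deltaE mul_tsum3r mul_tsum3l; apply: eq_tsum3 => Y1 Y2 Y3.
  by rewrite /Q !antipodeM !mulrA [Δ (_ * Y1)]rmorphM -!mulrA tensM !mulrA.
rewrite pentagon_sum3 //.
pose K (g Z2 Z3 : H) := \tsum_(z1, z2, z3 <- Φ^-1) \tsum_(x1, x2, x3 <- Φ^-1)
  \tsum_(c, d <- Δ x2)
    Δ (S (z1 * x1) * g * (z2 * c)) * p_R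
    * ((β * S (Z3 * x3)) ⊗ S (Z2 * z3 * d)).
have K1 Z2 Z3 : linear (fun g => K g Z2 Z3) by rewrite /K; linear_tac.
have K2 g Z3 : linear (fun Z2 => K g Z2 Z3) by rewrite /K; linear_tac.
have K3 g Z2 : linear (fun Z3 => K g Z2 Z3) by rewrite /K; linear_tac.
transitivity (\tsum_(Z1, Z2, Z3 <- Φ) \tsum_(a, b <- Δ Z1)
  K (S a * α * b) Z2 Z3).
  apply: eq_tsum3 => Z1 Z2 Z3; apply: eq_tsum => a b.
  apply: eq_tsum3 => z1 z2 z3; apply: eq_tsum3 => x1 x2 x3.
  by apply: eq_tsum => c d; rewrite /Q !antipodeM !mulrA.
under eq_tsum3 => Z1 Z2 Z3 do rewrite (antipode_alpha_sum _ (K1 Z2 Z3)).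
rewrite (counit_reassoc1_sum (F := K α)); last by linear_tac.
rewrite /K tsum33_exchange; apply: eq_tsum3 => x1 x2 x3.
rewrite (linear_tsum3E _ _ (f := fun s => _ * s * _)); last by linear_tac.
  apply: eq_tsum3 => z1 z2 z3.
transitivity (Δ (S x1) * Δ (S z1 * α * z2) * (p_R * (x2 ⊗ 1))
    * ((β * S x3) ⊗ S z3)).
  rewrite -coprod_pR.
  rewrite (linear_tsumE _ _ (f := fun s => _ * s * _)); last by linear_tac.
  apply: eq_tsum => c d.
  rewrite !mul1r !antipodeM -[in RHS](mulr1 (S x1)) !mulrA.
  rewrite !rmorphM /= -!mulrA tensM !mul1r rmorph1 mul1r.
  by rewrite !mulrA.
by rewrite -!mulrA !tensM !mulr1 !mul1r !mulrA.
Qed.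

(** The intertwining property of the Drinfeld twist. [twist_qR_mul] carries S(h_1) to the left;
    after coassociativity the two parts of h_2 collapse around β. *)
Lemma drinfeld_twistV_mul (h : H) :
  \tsum_(h1, h2 <- Δ h) drinfeld_twistV H * (S h2 ⊗ S h1)
  = Δ (S h) * drinfeld_twistV H.
Proof.
pose F (a b c : H) := Δ (S a) * twist_qR * ((b * β * S c) ⊗ 1).
have FT : trilinear F by rewrite /F; split; linear_tac.
transitivity (\tsum_(x1, x2, x3 <- Φ^-1) \tsum_(h1, h2 <- Δ h)
    \tsum_(a, b <- Δ h1) F (a * x1) (b * x2) (h2 * x3)).
  rewrite -tsum3_exchange; apply: eq_tsum => h1 h2.
  rewrite drinfeld_twistVE mul_tsum3l; apply: eq_tsum3 => x1 x2 x3.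
  transitivity (Δ (S x1) * (twist_qR * (1 ⊗ S h1))
      * ((x2 * β * S (h2 * x3)) ⊗ 1)).
    by rewrite -!mulrA !tensM !mul1r mulr1 antipodeM !mulrA.
  rewrite twist_qR_mul.
  rewrite (linear_tsumE _ _ (f := fun s => _ * s * _)); last by linear_tac.
  apply: eq_tsum => a b.
  rewrite /F [S (a * x1)]antipodeM rmorphM -!mulrA tensM mulr1.
  by rewrite !mulrA.
rewrite coassocV_sum // drinfeld_twistVE mul_tsum3r.
apply: eq_tsum3 => x1 x2 x3.
transitivity (F (x1 * h) x2 x3); last first.
  by rewrite /F antipodeM rmorphM !mulrA.
rewrite -(counit_r_sum (F := fun h => F (x1 * h) x2 x3) h); last first.
  by rewrite /F; linear_tac.
apply: eq_tsum => h1 h2.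
rewrite -(antipode_beta_sum (L := fun z =>
  Δ (S (x1 * h1)) * twist_qR * ((x2 * z * S x3) ⊗ 1))); last by linear_tac.
by apply: eq_tsum => a b; rewrite /F [S (x3 * b)]antipodeM !mulrA.
Qed.

(** By [twist_qR_mul] the factor S(X^1) passes to the left of [twist_qR], and what surrounds
    [twist_qR] is then the left side of [qR_pR_sum]. *)
Lemma drinfeld_twistV_qR :
  \tsum_(X1, X2, X3 <- Φ) drinfeld_twistV H * ((S X2 * α * X3) ⊗ S X1)
  = twist_qR.
Proof.
pose G (a b : H) := Δ (S a) * twist_qR * (b ⊗ 1).
have GB : is_bilinear G by rewrite /G; linear_tac.
transitivity (G 1 1); last first.
  by rewrite /G antipode1 rmorph1 mul1r mulr1.
rewrite -qR_pR_sum //; apply: eq_tsum3 => X1 X2 X3.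
rewrite tsum3_exchange drinfeld_twistVE mul_tsum3l.
apply: eq_tsum3 => x1 x2 x3.
transitivity (Δ (S x1) * (twist_qR * (1 ⊗ S X1))
    * ((x2 * β * (S (X2 * x3) * α * X3)) ⊗ 1)).
  by rewrite -!mulrA !tensM !mul1r mulr1 antipodeM !mulrA.
rewrite twist_qR_mul.
  rewrite (linear_tsumE _ _ (f := fun s => _ * s * _)); last by linear_tac.
  apply: eq_tsum => a b.
by rewrite /G [S (a * x1)]antipodeM rmorphM -!mulrA tensM mulr1 !mulrA.
Qed.

(** The form in which f^{-1} and q_R occur in [H0_coaction]. Both sides evaluate Δ(S(y)) multiplied
    by [twist_qR]; on the right no twist remains. *)
Lemma drinfeld_twistV_qR_sum (W : lmodType k) (F : H -> H -> W) (y : H) :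
  is_bilinear F ->
  \tsum_(y1, y2 <- Δ y) \tsum_(g1, g2 <- drinfeld_twistV H)
    \tsum_(q1, q2 <- q_R H) F (g1 * S (q2 * y2)) (g2 * S (q1 * y1))
  = \tsum_(x1, x2, x3 <- Φ^-1) \tsum_(c, d <- Δ (S (x1 * y) * α * x2))
    \tsum_(z1, z2, z3 <- Φ^-1) F (c * z1) (d * (z2 * β * S z3) * S x3).
Proof.
move=> FB; have evL : linear (fun t => tsum t F) by exact: tsum_linear.
transitivity (tsum (Δ (S y) * twist_qR) F).
  transitivity (\tsum_(y1, y2 <- Δ y) \tsum_(X1, X2, X3 <- Φ)
    tsum (drinfeld_twistV H * (S y2 ⊗ S y1) * ((S X2 * α * X3) ⊗ S X1)) F).
    apply: eq_tsum => y1 y2; rewrite tsum_exchange /q_R.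
    rewrite (linear_tsum3E _ _ (f := fun t =>
      \tsum_(q1, q2 <- t) \tsum_(g1, g2 <- drinfeld_twistV H)
        F (g1 * S (q2 * y2)) (g2 * S (q1 * y1)))); last by linear_tac.
    apply: eq_tsum3 => X1 X2 X3; rewrite tsum_tens; last by linear_tac.
    rewrite -mulrA tensM tsum_mul //; apply: eq_tsum => g1 g2.
    rewrite tsum_tens; last by linear_tac.
    by rewrite !antipodeM antipodeVK !mulrA.
  rewrite tsum3_exchange -drinfeld_twistV_qR.
  rewrite (linear_tsum3E _ _ (f := fun t => tsum (_ * t) F)); last by linear_tac.
  apply: eq_tsum3 => X1 X2 X3; rewrite mulrA -drinfeld_twistV_mul.
  by rewrite (linear_tsumE _ _ (f := fun t => tsum (t * _) F)) //; linear_tac.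
rewrite (linear_tsum3E _ _ (f := fun t => tsum (_ * t) F)); last by linear_tac.
apply: eq_tsum3 => x1 x2 x3.
transitivity (tsum (Δ (S (x1 * y) * α * x2) * (p_R * (1 ⊗ S x3))) F).
  by rewrite antipodeM !mulrA -rmorphM /= !mulrA.
rewrite tsum_mul //; apply: eq_tsum => c d.
rewrite (linear_tsum3E _ _ (f := fun t =>
  \tsum_(a, b <- t * _) F (c * a) (d * b))); last by linear_tac.
apply: eq_tsum3 => z1 z2 z3; rewrite tensM tsum_tens; last by linear_tac.
by rewrite mulr1 !mulrA.
Qed.

End DrinfeldTwist.

(** * The isomorphism *)

Section ModuleAlgebraTheory.
Variables (k : fieldType) (H : quasi_bialgebra k) (C : pre_module_algebra H).
Hypothesis CM : is_module_algebra C.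

Lemma module_algebra_mulAV (a b c : C) :
  pa_mul C a (pa_mul C b c)
  = \tsum_(x1, x2, x3 <- reassocV H)
      pa_mul C (pa_mul C (pma_act C x1 a) (pma_act C x2 b)) (pma_act C x3 c).
Proof.
have aB := ma_act_bilinear CM; have mB := ma_mul_bilinear CM.
pose F (x y z : H) :=
  pa_mul C (pma_act C x a) (pa_mul C (pma_act C y b) (pma_act C z c)).
have FT : trilinear F by rewrite /F; split; linear_tac.
transitivity (F 1 1 1); first by rewrite /F !(ma_act1 CM).
rewrite -reassoc_mulV_sum // tsum33_exchange; apply: eq_tsum3 => x1 x2 x3.
by rewrite (ma_mulA CM); apply: eq_tsum3 => X1 X2 X3; rewrite /F !(ma_actM CM).
Qed.

End ModuleAlgebraTheory.

Section DiamondToSmash.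
Variables (k : fieldType) (H : quasi_hopf k) (A : module_algebra H).
Local Notation "'Φ'" := (reassoc H).
Local Notation "'Φ^-1'" := (reassocV H).
Local Notation Δ := coprod.
Local Notation ε := counit.
Local Notation S := antipode.
Local Notation α := (qalpha H).
Local Notation β := (qbeta H).
Local Notation v := (@smash_inclusion k H A).
Local Notation C := (algebra_along v).
Local Notation "a ∙ a'" := (pa_mul A a a') (at level 40, left associativity).
Local Notation "h · a" := (pma_act A h a) (at level 35, right associativity).
Local Notation "s ⊙ t" := (pa_mul (smash A) s t)
  (at level 40, left associativity).
Local Notation "h ▷ b" := (along_act v h b)
  (at level 35, right associativity).
Local Notation "b ⋆ b'" := (along_mul v b b')
  (at level 40, left associativity).
Local Notation ψ := (along_op v).

Let actB : is_bilinear (pma_act A). Proof. exact: ma_act_bilinear (ma_axioms A). Qed.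
Let mulB : is_bilinear (pa_mul A). Proof. exact: ma_mul_bilinear (ma_axioms A). Qed.
Let act1 a : 1 · a = a. Proof. exact: ma_act1 (ma_axioms A) _. Qed.
Let actM h h' a : (h * h') · a = h · h' · a.
Proof. exact: ma_actM (ma_axioms A) _ _ _. Qed.

Let mB : is_bilinear (pa_mul (smash A)).
Proof. exact: smash_mul_bilinear. Qed.
Let mA (s t u : smash A) : s ⊙ (t ⊙ u) = s ⊙ t ⊙ u.
Proof. exact: smash_mulA. Qed.
Let m1l (t : smash A) : pa_one (smash A) ⊙ t = t.
Proof. exact: smash_mul1l. Qed.
Let m1r (t : smash A) : t ⊙ pa_one (smash A) = t.
Proof. exact: smash_mul1r. Qed.
Let vL : linear v.
Proof. by rewrite /smash_inclusion; linear_tac. Qed.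
Let v1 : v 1 = pa_one (smash A). Proof. by []. Qed.
Let vM h h' : v (h * h') = v h ⊙ v h'.
Proof. exact/esym/smash_mul_one_r. Qed.

Let aB := along_act_bilinear mB vL.
Let sB := along_mul_bilinear mB mA vL vM.
Let ψL := along_op_linear v mB.

Definition smash_embed (a : A) : smash A := a ⊗ 1.
Local Notation i := smash_embed.

Let iL : linear i.
Proof. by rewrite /smash_embed; linear_tac. Qed.
Let ivE a h : i a ⊙ v h = a ⊗ h.
Proof.
by transitivity (a ⊗ (1 * h)); [exact: smash_mul_one_r | rewrite mul1r].
Qed.
Let commute h a : v h ⊙ i a = \tsum_(h1, h2 <- Δ h) i (h1 · a) ⊙ v h2.
Proof. exact: smash_mul_commute. Qed.
Let iM a a' :
  i (a ∙ a') = \tsum_(X1, X2, X3 <- Φ) i (X1 · a) ⊙ i (X2 · a') ⊙ v X3.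
Proof. exact: smash_mul_embed. Qed.

(* The inclusion of A in (A # H)^j, not the naive a ↦ a # 1. *)
Definition diamond_embed (a : A) : smash A :=
  \tsum_(x1, x2, x3 <- Φ^-1) i (x1 · a) ⊙ v (x2 * β * S x3).
Local Notation ι := diamond_embed.

Let ιL : linear ι.
Proof. by rewrite /diamond_embed; linear_tac. Qed.

Lemma inclusion_mul_diamond_embed h a :
  v h ⊙ ι a = \tsum_(h1, h2 <- Δ h) \tsum_(x1, x2, x3 <- Φ^-1)
                i ((h1 * x1) · a) ⊙ v (h2 * (x2 * β * S x3)).
Proof.
rewrite (linear_tsum3E _ _ (f := fun s => _ ⊙ s)); last by linear_tac.
rewrite tsum3_exchange; apply: eq_tsum3 => x1 x2 x3; rewrite mA commute.
rewrite (linear_tsumE _ _ (f := fun s => s ⊙ _)); last by linear_tac.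
by apply: eq_tsum => h1 h2; rewrite actM !(vM, mA).
Qed.

(** The reason is [qR_pR_sum]. Conversely, [along_op_inv] shows that an equivariant map with this
    property must be ι, which explains the formula for ι. *)
Lemma along_op_diamond_embed a : ψ (ι a) = i a.
Proof.
pose G (x y : H) := i (x · a) ⊙ v y.
have GB : is_bilinear G by rewrite /G; linear_tac.
transitivity (G 1 1); last by rewrite /G act1 v1 m1r.
rewrite -qR_pR_sum //; apply: eq_tsum3 => X1 X2 X3.
rewrite inclusion_mul_diamond_embed.
rewrite (linear_tsumE _ _ (f := fun s => s ⊙ _)); last by linear_tac.
apply: eq_tsum => a1 a2.
rewrite (linear_tsum3E _ _ (f := fun s => s ⊙ _)); last by linear_tac.
by apply: eq_tsum3 => x1 x2 x3; rewrite /G !(antipodeM, vM, mA).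
Qed.

Lemma diamond_embed_act h a : ι (h · a) = h ▷ ι a.
Proof.
pose G (x y : H) := i (x · a) ⊙ v y.
have GB : is_bilinear G by rewrite /G; linear_tac.
transitivity (\tsum_(x1, x2, x3 <- Φ^-1) G (x1 * h) (x2 * β * S x3)).
  by apply: eq_tsum3 => x1 x2 x3; rewrite /G actM.
rewrite -coprod_pR_sum //; apply: eq_tsum => h1 h2.
rewrite inclusion_mul_diamond_embed.
rewrite (linear_tsumE _ _ (f := fun s => s ⊙ _)); last by linear_tac.
apply: eq_tsum => a1 a2.
rewrite (linear_tsum3E _ _ (f := fun s => s ⊙ _)); last by linear_tac.
by apply: eq_tsum3 => x1 x2 x3; rewrite /G !(antipodeM, vM, mA).
Qed.

Lemma diamond_embed_mull a b :
  ι a ⋆ b = \tsum_(x1, x2, x3 <- Φ^-1) i (x1 · a) ⊙ v x2 ⊙ b ⊙ v (S x3).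
Proof.
rewrite (along_mulE mB mA vL vM); apply: eq_tsum3 => x1 x2 x3.
by rewrite -diamond_embed_act along_op_diamond_embed.
Qed.

(** The Φ produced by [iM] and the Φ^{-1} of ι form the left side of [pentagon_beta1]. On the other
    side, one Φ^{-1} belongs to ⋆ and the other to ι(a'). *)
Lemma diamond_embed_mul a a' : ι (a ∙ a') = ι a ⋆ ι a'.
Proof.
pose G (x y z : H) := i (x · a) ⊙ i (y · a') ⊙ v z.
have GT : trilinear G by rewrite /G; split; linear_tac.
transitivity (\tsum_(X1, X2, X3 <- Φ) \tsum_(x1, x2, x3 <- Φ^-1)
    \tsum_(c, d <- Δ x1) G (X1 * c) (X2 * d) (X3 * x2 * β * S x3)).
  rewrite tsum33_exchange; apply: eq_tsum3 => x1 x2 x3.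
  rewrite (ma_act_mul (ma_axioms A)) (linear_tsumE _ _ iL).
  rewrite (linear_tsumE _ _ (f := fun s => s ⊙ _)); last by linear_tac.
  rewrite -tsum3_exchange; apply: eq_tsum => c d; rewrite iM.
  rewrite (linear_tsum3E _ _ (f := fun s => s ⊙ _)); last by linear_tac.
  by apply: eq_tsum3 => X1 X2 X3; rewrite /G !(actM, vM, mA).
rewrite pentagon_beta1 // diamond_embed_mull; apply: eq_tsum3 => x1 x2 x3.
rewrite -[i _ ⊙ v x2 ⊙ _]mA inclusion_mul_diamond_embed.
rewrite (linear_tsumE _ _ (f := fun s => _ ⊙ s ⊙ _)); last by linear_tac.
apply: eq_tsum => c d.
rewrite (linear_tsum3E _ _ (f := fun s => _ ⊙ s ⊙ _)); last by linear_tac.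
by apply: eq_tsum3 => y1 y2 y3; rewrite /G !(antipodeM, vM, mA).
Qed.

Lemma inclusion_H0_mul h h' : v (pa_mul (H0 H) h h') = v h ⋆ v h'.
Proof.
rewrite (linear_tsum3E _ _ vL); apply: eq_tsum3 => X1 X2 X3.
rewrite (linear_tsum3E _ _ vL); apply: eq_tsum3 => x1 x2 x3.
rewrite (linear_tsumE _ _ vL); apply: eq_tsum => c d.
by rewrite /= !vM.
Qed.

Lemma inclusion_H0_act h h' : v (pma_act (H0 H) h h') = h ▷ v h'.
Proof.
by rewrite (linear_tsumE _ _ vL); apply: eq_tsum => c d; rewrite /= !vM.
Qed.

Lemma diamond_to_smashE a h :
  diamond_to_smash (A := A) (a ⊗ h) = ι a ⋆ v h.
Proof.
rewrite diamond_to_smash_tens diamond_embed_mull; apply: eq_tsum3 => x1 x2 x3.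
by rewrite -!mA -!vM ivE mulrA.
Qed.

Lemma inclusion_diamond_embed h a :
  v h ⋆ ι a = \tsum_(c, h0 <- H0_coaction h) ι (c · a) ⋆ v h0.
Proof.
(* The coproduct of the third leg of Φ in the definition of ⋆ surrounds ι(a), and equivariance of ι
   absorbs it. *)
transitivity (\tsum_(Y1, Y2, Y3 <- Φ) \tsum_(z1, z2, z3 <- Φ^-1)
    v (Y1 * h * (S (z1 * Y2) * α * z2)) ⊙ ι (Y3 · a) ⊙ v (S z3)).
  rewrite along_mul_def.
  apply: eq_tsum3 => X1 X2 X3; apply: eq_tsum3 => x1 x2 x3.
  rewrite diamond_embed_act.
  rewrite (linear_tsumE _ _ (f := fun s => _ ⊙ s ⊙ _)); last by linear_tac.
  by apply: eq_tsum => c d; rewrite !(antipodeM, vM, mA).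
pose M (c h0 : H) := ι (c · a) ⋆ v h0.
have MB : is_bilinear M by rewrite /M; linear_tac.
(* The outer copy X in h_(-1) ⊗ h_(0) cancels the Φ^{-1} in the formula for ι(c · a) ⋆ j(h_0). *)
have MX p q r : \tsum_(X1, X2, X3 <- Φ) M (X1 * p) (X2 * q * S (X3 * r))
    = i (p · a) ⊙ v (q * S r).
  pose F (x y z : H) := i (x · p · a) ⊙ v (y * q * S (z * r)).
  have FT : trilinear F by rewrite /F; split; linear_tac.
  transitivity (F 1 1 1); last by rewrite /F act1 !mul1r.
  rewrite -reassoc_Vmul_sum // tsum33_exchange; apply: eq_tsum3 => X1 X2 X3.
  rewrite /M diamond_embed_mull; apply: eq_tsum3 => x1 x2 x3.
  by rewrite /F !(actM, antipodeM, vM, mA).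
transitivity (\tsum_(Y1, Y2, Y3 <- Φ) \tsum_(Y11, Y12 <- Δ Y1)
    \tsum_(Y21, Y22 <- Δ Y2) \tsum_(h1, h2 <- Δ h)
    \tsum_(g1, g2 <- drinfeld_twistV H) \tsum_(q1, q2 <- q_R H)
      i ((Y11 * h1 * (g1 * S (q2 * Y22)) * Y3) · a)
      ⊙ v (Y12 * h2 * (g2 * S (q1 * Y21)))); last first.
  have ML : linear (fun t => tsum t M) by exact: tsum_linear.
  rewrite (linear_tsum3E _ _ ML).
  under [RHS]eq_tsum3 => X1 X2 X3 do rewrite (linear_tsum3E _ _ ML).
  rewrite [RHS]tsum33_exchange; apply: eq_tsum3 => Y1 Y2 Y3.
  under [RHS]eq_tsum3 => X1 X2 X3 do rewrite (linear_tsumE _ _ ML).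
  rewrite -[RHS]tsum3_exchange; apply: eq_tsum => Y11 Y12.
  under [RHS]eq_tsum3 => X1 X2 X3 do rewrite (linear_tsumE _ _ ML).
  rewrite -[RHS]tsum3_exchange; apply: eq_tsum => Y21 Y22.
  under [RHS]eq_tsum3 => X1 X2 X3 do rewrite (linear_tsumE _ _ ML).
  rewrite -[RHS]tsum3_exchange; apply: eq_tsum => h1 h2.
  under [RHS]eq_tsum3 => X1 X2 X3 do rewrite (linear_tsumE _ _ ML).
  rewrite -[RHS]tsum3_exchange; apply: eq_tsum => g1 g2.
  under [RHS]eq_tsum3 => X1 X2 X3 do rewrite (linear_tsumE _ _ ML).
  rewrite -[RHS]tsum3_exchange; apply: eq_tsum => q1 q2.
  rewrite [Y12 * h2 * (g2 * _)]mulrA -MX; apply: eq_tsum3 => X1 X2 X3.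
  by rewrite tsum_tens // !mulrA.
apply: eq_tsum3 => Y1 Y2 Y3.
(* Eliminating the twist leaves Δ(S(z^1 Y^2) α z^2). With Δ(Y^1) and Δ(h) it forms the coproduct of
   the whole element to the left of ι on the other side. *)
under [RHS]eq_tsum => Y11 Y12.
  rewrite tsum_exchange.
  under eq_tsum => h1 h2.
    rewrite (drinfeld_twistV_qR_sum (F := fun u w =>
      i ((Y11 * h1 * u * Y3) · a) ⊙ v (Y12 * h2 * w))); last by linear_tac.
    over.
  rewrite tsum3_exchange.
  over.
rewrite [RHS]tsum3_exchange; apply: eq_tsum3 => z1 z2 z3.
rewrite inclusion_mul_diamond_embed.
rewrite (linear_tsumE _ _ (f := fun s => s ⊙ _)); last by linear_tac.
rewrite coprodM_sum; last by linear_tac.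
rewrite coprodM_sum; last by linear_tac.
apply: eq_tsum => Y11 Y12; apply: eq_tsum => h1 h2; apply: eq_tsum => c d.
rewrite (linear_tsum3E _ _ (f := fun s => s ⊙ _)); last by linear_tac.
by apply: eq_tsum3 => y1 y2 y3; rewrite !(actM, vM, mA).
Qed.

Let CM : is_module_algebra C.
Proof. exact: algebra_along_is_module_algebra. Qed.

Local Notation Π := (@diamond_to_smash k H A).

Lemma diamond_to_smash_linear : linear (Π : (A ⊗ H)%type -> (A ⊗ H)%type).
Proof. by rewrite /diamond_to_smash; linear_tac. Qed.
Let ΠL := diamond_to_smash_linear.

Let mH : is_bilinear (pa_mul (pre_algebra_of H)).
Proof.
have mulH : is_bilinear (fun x y : H => x * y) by linear_tac.
exact: mulH.
Qed.

Let H0_actB : is_bilinear (pma_act (H0 H)).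
Proof. exact: (along_act_bilinear mH (@linear_ident k H)). Qed.

Let H0_mulB : is_bilinear (pa_mul (H0 H)).
Proof.
by apply: (along_mul_bilinear mH _ (@linear_ident k H)) => *; rewrite /= ?mulrA.
Qed.

Lemma diamond_to_smash_act (h : H) (t : diamond A) :
  Π (pma_act (diamond A) h t) = h ▷ Π t.
Proof.
(* A convertible copy of the action on A ⋄ H_0, spelled out on A ⊗ H so that [linear_tac] can read
   it; [dmul] below plays the same role for the product. *)
pose act_diamond (t : A ⊗ H) : A ⊗ H := \tsum_(a, h' <- t)
  \tsum_(h1, h2 <- Δ h) (h1 · a) ⊗ (pma_act (H0 H) h2 h').
have actL : linear act_diamond by rewrite /act_diamond; linear_tac.
move: t; apply: (tensor_ext (G := fun t => Π (act_diamond t))).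
- by linear_tac.
- by linear_tac.
move=> a h'; rewrite diamond_to_smashE (along_act_mul mB mA vL vM).
rewrite /act_diamond tsum_tens; last by linear_tac.
rewrite (linear_tsumE _ _ ΠL); apply: eq_tsum => h1 h2.
by rewrite diamond_to_smashE diamond_embed_act inclusion_H0_act.
Qed.

Let sM h b b' :
  h ▷ (b ⋆ b') = \tsum_(h1, h2 <- Δ h) (h1 ▷ b) ⋆ (h2 ▷ b').
Proof. exact: (ma_act_mul CM). Qed.
Let sA b b' b'' :
  b ⋆ b' ⋆ b'' = \tsum_(X1, X2, X3 <- Φ) (X1 ▷ b) ⋆ ((X2 ▷ b') ⋆ (X3 ▷ b'')).
Proof. exact: (ma_mulA CM). Qed.
Let sAV b b' b'' :
  b ⋆ (b' ⋆ b'')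
  = \tsum_(x1, x2, x3 <- Φ^-1) (x1 ▷ b) ⋆ (x2 ▷ b') ⋆ (x3 ▷ b'').
Proof. exact: (module_algebra_mulAV CM). Qed.
Let aM h h' b : (h * h') ▷ b = h ▷ h' ▷ b.
Proof. exact: (ma_actM CM). Qed.

Lemma H0_coaction_linear : linear (@H0_coaction k H).
Proof. by rewrite /H0_coaction; linear_tac. Qed.

(** The four reassociators in the product of A ⋄ H_0 record the rebracketing of (ι(a) ⋆ j(h)) ⋆
    (ι(a') ⋆ j(h')): X and x bring j(h) next to ι(a'), the coaction interchanges them, then Y and y
    collect the two ι and the two j. *)
Lemma diamond_to_smash_mul (s t : diamond A) :
  Π (pa_mul (diamond A) s t) = Π s ⋆ Π t.
Proof.
have coL := H0_coaction_linear.
pose dmul (s t : A ⊗ H) : A ⊗ H :=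
  \tsum_(a, h <- s) \tsum_(a', h' <- t)
  \tsum_(X1, X2, X3 <- Φ) \tsum_(X31, X32 <- Δ X3)
  \tsum_(x1, x2, x3 <- Φ^-1) \tsum_(Y1, Y2, Y3 <- Φ)
  \tsum_(y1, y2, y3 <- Φ^-1) \tsum_(y31, y32 <- Δ y3)
  \tsum_(c, h0 <- H0_coaction (pma_act (H0 H) (x1 * X2) h))
    ((y1 * X1) · a) ∙ ((y2 * Y1 * c * x2 * X31) · a')
    ⊗ pa_mul (H0 H) (pma_act (H0 H) (y31 * Y2) h0)
                    (pma_act (H0 H) (y32 * Y3 * x3 * X32) h').
have dB : is_bilinear dmul by rewrite /dmul; linear_tac.
move: s; apply: (tensor_ext (G := fun s => Π (dmul s t))); try by linear_tac.
move=> a h.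
move: t; apply: (tensor_ext (G := fun t => Π (dmul (a ⊗ h) t)));
  try by linear_tac.
move=> a' h'; rewrite /dmul tsum_tens; last by linear_tac.
rewrite tsum_tens; last by linear_tac.
rewrite !diamond_to_smashE sA (linear_tsum3E _ _ ΠL).
apply: eq_tsum3 => X1 X2 X3; rewrite sM.
rewrite (linear_tsumE _ _ (f := fun s => _ ⋆ (_ ⋆ s))); last by linear_tac.
rewrite (linear_tsumE _ _ ΠL); apply: eq_tsum => X31 X32.
rewrite [(X2 ▷ _) ⋆ _]sAV (linear_tsum3E _ _ (f := fun s => _ ⋆ s)); last by linear_tac.
rewrite (linear_tsum3E _ _ ΠL); apply: eq_tsum3 => x1 x2 x3.
rewrite -[x1 ▷ _]aM -[(x1 * X2) ▷ _]inclusion_H0_act.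
rewrite -[x2 ▷ _]aM -[(x2 * X31) ▷ _]diamond_embed_act.
rewrite inclusion_diamond_embed.
rewrite (linear_tsumE _ _ (f := fun s => _ ⋆ (s ⋆ _))); last by linear_tac.
(* The definition of the product sums over the coaction innermost, whereas here it arises before Y
   and y. *)
transitivity (\tsum_(c, h0 <- H0_coaction (pma_act (H0 H) (x1 * X2) h))
  \tsum_(Y1, Y2, Y3 <- Φ) \tsum_(y1, y2, y3 <- Φ^-1)
  \tsum_(y31, y32 <- Δ y3)
    Π (((y1 * X1) · a) ∙ ((y2 * Y1 * c * x2 * X31) · a')
      ⊗ pa_mul (H0 H) (pma_act (H0 H) (y31 * Y2) h0)
                      (pma_act (H0 H) (y32 * Y3 * x3 * X32) h'))).
  rewrite tsum3_exchange (linear_tsum3E _ _ ΠL); apply: eq_tsum3 => Y1 Y2 Y3.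
  rewrite tsum3_exchange (linear_tsum3E _ _ ΠL); apply: eq_tsum3 => y1 y2 y3.
  rewrite tsum_exchange (linear_tsumE _ _ ΠL); apply: eq_tsum => y31 y32.
  exact: linear_tsumE.
apply: eq_tsum => c h0; rewrite sA.
rewrite (linear_tsum3E _ _ (f := fun s => _ ⋆ s)); last by linear_tac.
apply: eq_tsum3 => Y1 Y2 Y3; rewrite sAV; apply: eq_tsum3 => y1 y2 y3.
rewrite sM (linear_tsumE _ _ (f := fun s => _ ⋆ s)); last by linear_tac.
apply: eq_tsum => y31 y32.
rewrite diamond_to_smashE diamond_embed_mul inclusion_H0_mul.
by rewrite !(diamond_embed_act, inclusion_H0_act, actM, aM).
Qed.

Lemma diamond_to_smash_one : Π (pa_one (diamond A)) = v β.
Proof.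
rewrite diamond_to_smash_tens.
transitivity (\tsum_(x1, x2, x3 <- Φ^-1)
    ε x1 *: (pa_one A ⊗ x2 * β * S x3)).
  apply: eq_tsum3 => x1 x2 x3; rewrite (ma_act_one (ma_axioms A)).
  by rewrite tensZl.
rewrite (counit_reassocV1_sum (F := fun x2 x3 => pa_one A ⊗ x2 * β * S x3)).
  by rewrite mul1r antipode1 mulr1.
by linear_tac.
Qed.

Lemma diamond_to_smash_bijective : bijective Π.
Proof.
pose Θ (t : A ⊗ H) : A ⊗ H := \tsum_(a, h <- t)
  \tsum_(X1, X2, X3 <- Φ) (X1 · a) ⊗ X2 * h * S X3.
have ΘL : linear Θ by rewrite /Θ; linear_tac.
have ΘE a h :
    Θ (a ⊗ h) = \tsum_(X1, X2, X3 <- Φ) (X1 · a) ⊗ X2 * h * S X3.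
  by rewrite /Θ tsum_tens //; linear_tac.
pose F a h (x y z : H) := (x · a) ⊗ y * h * S z.
have FT a h : trilinear (F a h) by rewrite /F; split; linear_tac.
have F1 a h : F a h 1 1 1 = a ⊗ h.
  by rewrite /F act1 antipode1 mul1r mulr1.
exists Θ.
  apply: (tensor_ext (G := fun t => Θ (Π t)) (G' := id)) => [||a h].
  - by linear_tac.
  - exact: linear_ident.
  rewrite diamond_to_smash_tens (linear_tsum3E _ _ ΘL).
  rewrite -F1 -reassoc_mulV_sum // tsum33_exchange; apply: eq_tsum3 => x1 x2 x3.
  rewrite ΘE; apply: eq_tsum3 => X1 X2 X3.
  by rewrite /F actM antipodeM !mulrA.
apply: (tensor_ext (G := fun t => Π (Θ t)) (G' := id)) => [||a h].
- by linear_tac.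
- exact: linear_ident.
rewrite ΘE (linear_tsum3E _ _ ΠL).
rewrite -F1 -reassoc_Vmul_sum // tsum33_exchange; apply: eq_tsum3 => X1 X2 X3.
rewrite diamond_to_smash_tens; apply: eq_tsum3 => x1 x2 x3.
by rewrite /F actM antipodeM !mulrA.
Qed.

Lemma smash_along_is_module_algebra : is_module_algebra C.
Proof. exact: CM. Qed.

End DiamondToSmash.

(** Every axiom is an identity between expressions that [f] preserves, so by injectivity it may be
    checked after applying [f]. *)
Lemma module_algebra_transport (k : fieldType) (H : quasi_bialgebra k)
    (A B : pre_module_algebra H) (f : A -> B) :
  is_module_algebra B -> is_module_algebra_morphism f -> injective f ->
  is_module_algebra A.
Proof.
move=> BM [fL fact fmul fone] fI.
have aB := ma_act_bilinear BM; have mB := ma_mul_bilinear BM.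
split.
- split=> [a|h] c x y; apply: fI; rewrite /= fL !fact ?fL.
    exact: aB.1.
  exact: aB.2.
- by move=> a; apply: fI; rewrite fact (ma_act1 BM).
- by move=> h h' a; apply: fI; rewrite !fact (ma_actM BM).
- split=> [a|a] c x y; apply: fI; rewrite /= fL !fmul fL.
    exact: mB.1.
  exact: mB.2.
- by move=> a; apply: fI; rewrite fmul fone (ma_mul1l BM).
- by move=> a; apply: fI; rewrite fmul fone (ma_mul1r BM).
- move=> a a' a''; apply: fI; rewrite !fmul (ma_mulA BM) (linear_tsum3E _ _ fL).
  by apply: eq_tsum3 => X1 X2 X3; rewrite !fmul !fact.
- move=> h a a'; apply: fI; rewrite fact fmul (ma_act_mul BM).
  by rewrite (linear_tsumE _ _ fL); apply: eq_tsum => h1 h2; rewrite fmul !fact.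
- by move=> h; apply: fI; rewrite fact fone (ma_act_one BM) (linear_scale fL) fone.
Qed.

Theorem proposition3p2 (k : fieldType) (H : quasi_hopf k)
    (A : module_algebra H) :
  is_module_algebra_iso (A := diamond A)
    (B := algebra_along (@smash_inclusion k H A))
    (@diamond_to_smash k H A).
Proof.
have BM := smash_along_is_module_algebra A.
have fM : is_module_algebra_morphism (@diamond_to_smash k H A).
  split.
  - exact: diamond_to_smash_linear.
  - exact: diamond_to_smash_act.
  - exact: diamond_to_smash_mul.
  - exact: diamond_to_smash_one.
have fB := diamond_to_smash_bijective A.
by split=> //; apply: module_algebra_transport BM fM (bij_inj fB).
Qed.
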